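(* Let $g$ be a pseudo-Riemannian metric on a manifold $M$, let $L$ be a $(1,1)$-tensor field on $M$ compatible with $g$, and let $p\in M$ be a regular point. Suppose that in a connected neighborhood $U$ of $p$ the operator $L$ has either a unique real eigenvalue $\lambda=\lambda(x)$ (and no other complex eigenvalues), or a unique pair of complex conjugate eigenvalues $\lambda(x),\bar\lambda(x)$ with $\mathrm{Im}\,\lambda(x)\neq 0$ (and no other eigenvalues), where $\lambda$ is a continuous function on $U$. Suppose that the geometric multiplicity of $\lambda(x)$ is at least two at each point $x\in U$. Then the function $\lambda$ is constant on $U$ and $L$ is covariantly constant in $U$, i.e. $\nabla L=0$ on $U$, where $\nabla$ is the Levi-Civita connection of $g$. In particular, on $U$ the metrics $g$ and $\bar g(\cdot,\cdot)=\frac{1}{|\det L|}\,g(L^{-1}\cdot,\cdot)$ are affinely equivalent.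
   Context: All objects are smooth; metrics may have arbitrary signature. A $(1,1)$-tensor field $L$ (viewed as a field of endomorphisms of $TM$) is called compatible with $g$ if $L$ is $g$-selfadjoint, nondegenerate at every point, and satisfies, at every point and for every tangent vector $u$, $$\nabla_u L=\tfrac12\bigl(u\otimes d\,\mathrm{tr}\,L+(u\otimes d\,\mathrm{tr}\,L)^*\bigr),$$ where $\nabla$ is the Levi-Civita connection of $g$, $u\otimes\alpha$ denotes the operator $v\mapsto\alpha(v)u$, and $*$ denotes the $g$-adjoint ($g(Av,w)=g(v,A^*w)$). A point $p$ is regular if in some neighborhood of $p$ the Jordan type of $L$ is constant (the number of distinct eigenvalues and the number and sizes of the Jordan blocks are the same at all points; the eigenvalues themselves may vary). The geometric multiplicity of an eigenvalue is the number of linearly independent eigenvectors (over $\mathbb C$, in the complexified tangent space, if the eigenvalue is not real). Two metrics are affinely equivalent if they have the same Levi-Civita connection. *)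

(* Defs.v *)
From HB Require Import structures.
From mathcomp Require Import all_boot all_order all_algebra.
From mathcomp Require Import all_classical all_reals all_analysis.
From mathcomp Require Import complex.

Set Implicit Arguments.
Unset Strict Implicit.
Unset Printing Implicit Defensive.

Import Order.TTheory GRing.Theory Num.Theory.
Import numFieldNormedType.Exports.

Local Open Scope classical_set_scope.
Local Open Scope ring_scope.
Local Open Scope complex_scope.

(* Row-vector convention throughout: the matrix A acts by v |-> v *m A, as
   in the library's [eigenvalue], [eigenspace] and [jacobian]. *)

Section Smooth.
Context {R : realType} {n : nat} {V : normedModType R}.
Implicit Types (A : set 'rV[R]_n) (f : 'rV[R]_n -> V).

(* Meaningful for open A. *)
Fixpoint Ck_on (k : nat) A f : Prop :=
  if k is k'.+1 then
    (forall x, A x -> differentiable f x) /\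
    (forall u : 'rV[R]_n, Ck_on k' A (fun x => 'D_u f x))
  else forall x, A x -> {for x, continuous f}.

Definition smooth_on A f : Prop := forall k, Ck_on k A f.

End Smooth.

(* [cmap c] and [cinv c] are total functions, but only their restrictions to
   [cdom c] and to [cmap c @` cdom c] matter. *)
Record smooth_manifold (R : realType) (n : nat) := SmoothManifold {
  points :> topologicalType;
  chart : Type;
  cdom : chart -> set points;
  cmap : chart -> points -> 'rV[R]_n;
  cinv : chart -> 'rV[R]_n -> points;
  points_hausdorff : hausdorff_space points;
  points_second_countable : @second_countable points;
  cdom_open : forall c, open (cdom c);
  cimage_open : forall c, open (cmap c @` cdom c);
  cmapK : forall c x, cdom c x -> cinv c (cmap c x) = x;
  cmap_continuous : forall c, {within cdom c, continuous (cmap c)};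
  cinv_continuous : forall c,
    {within cmap c @` cdom c, continuous (cinv c)};
  cdom_cover : forall x, exists c, cdom c x;
  transition_smooth : forall c d,
    smooth_on (cmap c @` (cdom c `&` cdom d)) (cmap d \o cinv c) }.

Section Tensors.
Context {R : realType} {n : nat} (M : smooth_manifold R n).

(* A tensor field of rank two is the family of its component matrices, one
   for each chart; T c x is relevant only when x is in the domain of c. *)
Definition components := chart M -> M -> 'M[R]_n.

Definition in_chart {V : Type} (c : chart M) (f : M -> V) : 'rV[R]_n -> V :=
  f \o cinv c.

(* A tangent vector at x with coordinates v in the chart c has coordinates
   v *m transition_jacobian c d x in the chart d. *)
Definition transition_jacobian (c d : chart M) (x : M) : 'M[R]_n :=
  jacobian (cmap d \o cinv c) (cmap c x).

Definition smooth_components (W : set M) (T : components) : Prop :=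
  forall c, smooth_on (cmap c @` (cdom c `&` W)) (in_chart c (T c)).

(* g(v, w) = v *m g c x *m w^T in the chart c. *)
Definition bilinear_field_on (W : set M) (g : components) : Prop :=
  smooth_components W g /\
  forall c d x, W x -> cdom c x -> cdom d x ->
    let J := transition_jacobian c d x in g c x = J *m g d x *m J^T.

(* L(v) = v *m L c x in the chart c. *)
Definition endo_field_on (W : set M) (L : components) : Prop :=
  smooth_components W L /\
  forall c d x, W x -> cdom c x -> cdom d x ->
    let J := transition_jacobian c d x in L c x *m J = J *m L d x.

Definition pseudo_riemannian_on (W : set M) (g : components) : Prop :=
  bilinear_field_on W g /\
  forall c x, W x -> cdom c x -> (g c x)^T = g c x /\ g c x \in unitmx.

Definition partial (c : chart M) {V : normedModType R} (f : M -> V)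
    (u : 'rV[R]_n) (x : M) : V :=
  'D_u (in_chart c f) (cmap c x).

Definition christoffel (g : components) (c : chart M) (x : M)
    (i k l : 'I_n) : R :=
  let dg j := partial c (g c) (delta_mx 0 j) x in
  2^-1 * \sum_m invmx (g c x) i m * (dg k m l + dg l m k - dg m k l).

(* nabla_u v = D_u v + v *m connection_mx g c x u for the Levi-Civita
   connection nabla of g. *)
Definition connection_mx (g : components) (c : chart M) (x : M)
    (u : 'rV[R]_n) : 'M[R]_n :=
  \matrix_(l, i) \sum_k u 0 k * christoffel g c x i k l.

(* From (nabla_u L)(v) = nabla_u (L v) - L (nabla_u v). *)
Definition nabla_endo (g L : components) (c : chart M) (x : M)
    (u : 'rV[R]_n) : 'M[R]_n :=
  let C := connection_mx g c x u in
  partial c (L c) u x + L c x *m C - C *m L c x.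

Definition selfadjoint_mx (G A : 'M[R]_n) : Prop :=
  forall v w : 'rV[R]_n, (v *m A) *m G *m w^T = v *m G *m (w *m A)^T.

Definition adjoint_mx (G A : 'M[R]_n) : 'M[R]_n := (invmx G *m A *m G)^T.

Lemma adjoint_mxP (G A : 'M[R]_n) (v w : 'rV[R]_n) : G \in unitmx ->
  (v *m A) *m G *m w^T = v *m G *m (w *m adjoint_mx G A)^T.
Proof.
by move=> Gu; rewrite /adjoint_mx trmx_mul trmxK !mulmxA mulmxK.
Qed.

Definition dtrace (L : components) (c : chart M) (x : M) : 'cV[R]_n :=
  \col_j partial c (fun y => \tr (L c y)) (delta_mx 0 j) x.

(* The operator v |-> alpha(v) u, where alpha(v) = v *m a. *)
Definition tensor_op (u : 'rV[R]_n) (a : 'cV[R]_n) : 'M[R]_n := a *m u.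

Definition compatible (g L : components) : Prop :=
  endo_field_on setT L /\
  forall c x, cdom c x ->
    [/\ selfadjoint_mx (g c x) (L c x),
        L c x \in unitmx &
        forall u : 'rV[R]_n,
          let A := tensor_op u (dtrace L c x) in
          nabla_endo g L c x u = 2^-1 *: (A + adjoint_mx (g c x) A)].

Definition parallel_on (U : set M) (g L : components) : Prop :=
  forall c x, U x -> cdom c x -> forall u, nabla_endo g L c x u = 0.

Definition affinely_equivalent_on (U : set M) (g h : components) : Prop :=
  [/\ pseudo_riemannian_on U g, pseudo_riemannian_on U h &
      forall c x, U x -> cdom c x ->
        forall i k l, christoffel g c x i k l = christoffel h c x i k l].

Definition gbar (g L : components) : components :=
  fun c x => `|\det (L c x)|^-1 *: (invmx (L c x) *m g c x).

End Tensors.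

Section Jordan.
Context {R : realType}.

Definition complexify {n} (A : 'M[R]_n) : 'M[R[i]]_n :=
  map_mx (real_complex R) A.

Definition jordan_block (z : R[i]) (k : nat) : 'M[R[i]]_k :=
  \matrix_(i, j) if i == j then z else if i.+1 == j :> nat then 1 else 0.

(* A has d distinct complex eigenvalues, and s lists the sizes of its Jordan
   blocks. P is square and invertible: its two dimensions are equal numbers,
   though not convertible. *)
Definition has_jordan_type {n} (A : 'M[R]_n) (d : nat) (s : seq nat) : Prop :=
  let k (i : 'I_(size s)) := nth 0%N s i in
  all (fun m => 0 < m)%N s /\
  exists (a : 'I_(size s) -> R[i]) (P : 'M[R[i]]_(n, \sum_i k i)),
    [/\ size (undup (codom a)) = d, row_free P, row_full P &
        complexify A *m P = P *m (\mxdiag_i jordan_block (a i) (k i))].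

Definition geometric_multiplicity {n} (A : 'M[R]_n) (z : R[i]) : nat :=
  if complex.Im z == 0 then \rank (eigenspace A (complex.Re z))
  else \rank (eigenspace (complexify A) z).

Definition regular_point {n} (M : smooth_manifold R n) (L : components M)
    (p : M) : Prop :=
  exists2 V : set M, nbhs p V &
  exists (d : nat) (s : seq nat), forall c x, V x -> cdom c x ->
    has_jordan_type (L c x) d s.

Definition unique_real_eigenvalue {n} (A : 'M[R]_n) (z : R[i]) : Prop :=
  complex.Im z = 0 /\ forall w, eigenvalue (complexify A) w <-> w = z.

Definition unique_complex_pair {n} (A : 'M[R]_n) (z : R[i]) : Prop :=
  complex.Im z <> 0 /\
  forall w, eigenvalue (complexify A) w <-> w = z \/ w = z^*.

End Jordan.

(* Main.v *)
Require Import Defs.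
From HB Require Import structures.
From mathcomp Require Import all_boot all_order all_algebra.
From mathcomp Require Import all_classical all_reals all_analysis.
From mathcomp Require Import complex.
From mathcomp Require Import zify ring lra.

Set Implicit Arguments.
Unset Strict Implicit.
Unset Printing Implicit Defensive.

Import Order.TTheory GRing.Theory Num.Theory.
Import numFieldNormedType.Exports.

Local Open Scope classical_set_scope.
Local Open Scope ring_scope.
Local Open Scope complex_scope.

(** The trace-free part T = L - tr L / n of the operator carries the
    argument. By compatibility its covariant derivative in the direction u
    is
      nabla_u T = (n / 2) (u (x) a + its adjoint) - a(u),    a = dtr L / n,
    and everything follows once a = 0. For then nabla L = 0, the eigenvalue
    is locally constant, and it is constant because the domain is
    connected.

    Suppose first that the eigenvalue is real. Then T is nilpotent.
    Differentiating tr T^2 = 0 gives that a vanishes on the image of T. Let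
    T^m = 0 on an open set. Because of what has just been said, only two
    terms survive in the Leibniz expansion of nabla_u (T^m) besides those
    that contain the scalar a(u), and the evaluation of the associated
    quadratic form at u itself gives
      (n - m) a(u) g(T^(m-1) u, u) = 0   for every u.
    A linear and a quadratic form whose product is 0 cannot both be
    nonzero, so T^(m-1) = 0 wherever a is not 0, provided that m < n. Going
    on like this on the open set where a is not 0, one arrives at T^0 = 0
    there: the set is empty (nilpotency_drop_real, nilpotency_descent). The
    geometric multiplicity enters only through m < n, since two independent
    eigenvectors force T^(n-1) = 0 (nilpotent_real).

    For a pair of complex eigenvalues, Q = T^2 + b^2 is nilpotent, b being
    the imaginary part; n is even, and two independent eigenvectors force
    Q^m = 0 for some m < n / 2 (nilpotent_pair). The same method works with
    Q in place of T: b^2 = - tr T^2 / n is differentiable, tr T^3 = 0 shows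
    that a vanishes on the image of Q, and the resulting cubic identity
    splits into a real and an imaginary part (nilpotency_drop_pair). No
    complex-valued function has to be differentiated.

    Finally det L is constant and L is parallel, so the connection of g,
    which is symmetric, preserves the metric gbar. Uniqueness of the
    Levi-Civita connection (koszul_unique) shows that it is the connection
    of gbar. The inverse of L is smooth because, the characteristic
    polynomial being constant, it is a polynomial in L with constant
    coefficients (smooth_invmx). *)

(** * Pointwise consequences of the compatibility equation *)

Section Bilinear.
Context {R : realType} {n : nat}.
Implicit Types (G A B Q S T Z : 'M[R]_n) (u v : 'rV[R]_n) (a : 'cV[R]_n).

Definition form S u v : R := (u *m S *m v^T) 0 0.

Lemma form_tr S u v : form S^T u v = form S v u.
Proof.
have tr11 (x : 'M[R]_1) : x 0 0 = x^T 0 0 by rewrite mxE.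
by rewrite /form [RHS]tr11 !trmx_mul trmxK mulmxA.
Qed.

Lemma form_sym S u v : S^T = S -> form S u v = form S v u.
Proof. by move=> Ss; rewrite -form_tr Ss. Qed.

Lemma formDl S u1 u2 v : form S (u1 + u2) v = form S u1 v + form S u2 v.
Proof. by rewrite /form !mulmxDl mxE. Qed.

Lemma formDr S v u1 u2 : form S v (u1 + u2) = form S v u1 + form S v u2.
Proof. by rewrite /form linearD mulmxDr mxE. Qed.

Lemma formNl S u v : form S (- u) v = - form S u v.
Proof. by rewrite /form !mulNmx mxE. Qed.

Lemma formNr S u v : form S u (- v) = - form S u v.
Proof. by rewrite /form linearN mulmxN mxE. Qed.

Lemma formZ b S u v : form (b *: S) u v = b * form S u v.
Proof. by rewrite /form -scalemxAr -scalemxAl mxE. Qed.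

Lemma formD S T u v : form (S + T) u v = form S u v + form T u v.
Proof. by rewrite /form mulmxDr mulmxDl mxE. Qed.

Lemma form_delta S i j : form S (delta_mx 0 i) (delta_mx 0 j) = S i j.
Proof. by rewrite /form -rowE trmx_delta -colE !mxE. Qed.

Lemma quadratic_form0 S : S^T = S -> (forall u, form S u u = 0) -> S = 0.
Proof.
move=> Ss S0; apply/matrixP => i j; rewrite mxE.
have := S0 (delta_mx 0 i + delta_mx 0 j).
rewrite formDl !formDr !S0 add0r addr0 (form_sym _ _ Ss) -mulr2n form_delta.
rewrite -mulr_natr => /eqP; rewrite mulf_eq0 pnatr_eq0 orbF => /eqP h.
by rewrite -Ss mxE.
Qed.

(** A product of two polynomials is 0 only if one of the factors is: if the
    linear form a is not 0, the quadratic form vanishes outside a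
    hyperplane, hence everywhere. *)
Lemma linear_quadratic0 a S : S^T = S ->
  (forall u, (u *m a) 0 0 * form S u u = 0) -> a = 0 \/ S = 0.
Proof.
move=> Ss h; have [->|a0] := eqVneq a 0; [by left|right].
apply: quadratic_form0 => // v.
have [u ua] : exists u : 'rV_n, (u *m a) 0 0 != 0.
  have /matrix0Pn[i [j aij]] := a0; exists (delta_mx 0 i).
  by rewrite -rowE mxE -(ord1 j).
have nz w : (w *m a) 0 0 != 0 -> form S w w = 0.
  by move=> wa; have /eqP := h w; rewrite mulf_eq0 (negbTE wa) => /eqP.
have [va|/nz//] := eqVneq ((v *m a) 0 0) 0.
(* u + v and u - v lie outside the kernel of a, and by the parallelogram law
   the quadratic form is 0 at v if it is 0 at u, u + v and u - v. *)
have aD w : ((u + w) *m a) 0 0 = (u *m a) 0 0 + (w *m a) 0 0.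
  by rewrite mulmxDl [LHS]mxE.
have aN : ((- v) *m a) 0 0 = 0 by rewrite mulNmx mxE va oppr0.
have /nz : ((u + v) *m a) 0 0 != 0 by rewrite aD va addr0.
have /nz : ((u - v) *m a) 0 0 != 0 by rewrite aD aN addr0.
rewrite !(formDl, formDr, formNl, formNr) (nz u ua) (form_sym v u Ss).
lra.
Qed.

Lemma adjoint_mxM G A : G \in unitmx -> G^T = G ->
  adjoint_mx G A *m G = G *m A^T.
Proof.
move=> Gu Gs; rewrite /adjoint_mx !trmx_mul Gs trmx_inv Gs.
by rewrite -!mulmxA mulVmx // mulmx1.
Qed.

Lemma selfadjointX G Q k : Q *m G = G *m Q^T -> Q ^+ k *m G = G *m (Q ^+ k)^T.
Proof.
move=> Qs; elim: k => [|k IH]; first by rewrite expr0 mul1mx trmx1 mulmx1.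
rewrite exprSr -mulmxE -mulmxA Qs mulmxA IH -mulmxA -trmx_mul mulmxE.
by rewrite -exprS -exprSr.
Qed.

(** Write B' for the adjoint of B. If D is a derivation and D Q = c (B +
    B') - Z, the sum is the Leibniz expansion of D (Q ^+ m.+1). As Q kills
    B on one side and B' on the other, the sum reduces to c (B Q^m + Q^m
    B') - m.+1 Z Q^m. Here B Q^m and Q^m B' are adjoint to each other, so
    they define the same quadratic form. *)
Lemma leibniz_collapse m G Q B Z (c : R) :
  G \in unitmx -> G^T = G -> Q *m G = G *m Q^T -> Q *m B = 0 ->
  Z *m Q = Q *m Z ->
  \sum_(i < m.+1) Q ^+ i *m (c *: (B + adjoint_mx G B) - Z) *m Q ^+ (m - i) = 0
    ->
  forall u, 2 * c * form (B *m Q ^+ m *m G) u u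
    = m.+1%:R * form (Z *m Q ^+ m *m G) u u.
Proof.
move=> Gu Gs Qs QB ZQ E0 u.
have BQ : adjoint_mx G B *m Q = 0.
  rewrite -[Q](mulmxK Gu) Qs !mulmxA adjoint_mxM // -(mulmxA G) -trmx_mul QB.
  by rewrite trmx0 mulmx0 mul0mx.
have ZX k : Z *m Q ^+ k = Q ^+ k *m Z.
  elim: k => [|k IH]; first by rewrite expr0 mul1mx mulmx1.
  by rewrite exprSr -mulmxE mulmxA IH -!mulmxA ZQ.
have S1 : \sum_(i < m.+1) Q ^+ i *m B *m Q ^+ (m - i) = B *m Q ^+ m.
  rewrite big_ord_recl expr0 mul1mx subn0 big1 ?addr0 // => i _.
  by rewrite /= exprSr -mulmxE -(mulmxA _ Q) QB mulmx0 mul0mx.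
have S2 : \sum_(i < m.+1) Q ^+ i *m adjoint_mx G B *m Q ^+ (m - i)
    = Q ^+ m *m adjoint_mx G B.
  rewrite big_ord_recr /= subnn expr0 mulmx1 big1 ?add0r // => i _.
  by rewrite -(subnSK (ltn_ord i)) exprS -mulmxE mulmxA -(mulmxA _ _ Q) BQ
    mulmx0 mul0mx.
have S3 : \sum_(i < m.+1) Q ^+ i *m Z *m Q ^+ (m - i) =
  m.+1%:R *: (Z *m Q ^+ m).
  rewrite (eq_bigr (fun=> Z *m Q ^+ m)) ?sumr_const ?card_ord ?scaler_nat // =>
    i _.
  by rewrite -ZX -mulmxA mulmxE -exprD subnKC // -ltnS.
have {}E0 : c *: (B *m Q ^+ m + Q ^+ m *m adjoint_mx G B)
    = m.+1%:R *: (Z *m Q ^+ m).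
  apply/subr0_eq; rewrite -[RHS]E0 -S1 -S2 -S3.
  rewrite -[X in c *: X]big_split /= scaler_sumr -sumrB; apply: eq_bigr => i _.
  by rewrite mulmxBr mulmxBl -scalemxAr -scalemxAl mulmxDr mulmxDl.
have BE : form (Q ^+ m *m adjoint_mx G B *m G) u u =
  form (B *m Q ^+ m *m G) u u.
  rewrite -mulmxA adjoint_mxM // mulmxA (selfadjointX m Qs) -mulmxA -trmx_mul.
  by rewrite -[LHS]form_tr [(G *m _)^T]trmx_mul trmxK Gs.
rewrite -[RHS]formZ scalemxAl -E0 -scalemxAl formZ mulmxDl formD BE.
ring.
Qed.

Lemma formMl S a u v w : form (a *m w *m S) u v = (u *m a) 0 0 * form S w v.
Proof.
rewrite /form !mulmxA [u *m a]mx11_scalar mul_scalar_mx -!scalemxAl mxE.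
by rewrite [in RHS]mxE eqxx mulr1n.
Qed.

(** The alternative on which the descent rests: g is nondegenerate, so Q ^+
    m vanishes with its form. *)
Lemma power_form0 a G Q m : G \in unitmx -> G^T = G -> Q *m G = G *m Q^T ->
  (forall u, (u *m a) 0 0 * form (Q ^+ m *m G) u u = 0) -> a = 0 \/ Q ^+ m = 0.
Proof.
move=> Gu Gs Qs /linear_quadratic0[|->|QG]; [|by left|right].
  by rewrite trmx_mul Gs selfadjointX.
by rewrite -[LHS](mulmxK Gu) QG mul0mx.
Qed.

(** If the covariant derivative of T has the form that compatibility
    imposes, then differentiating T ^+ m.+1 = 0 gives (n - m.+1) a(u) g(T^m
    u, u) = 0 for every u. Hence T ^+ m = 0, unless a = 0. *)
Lemma nilpotency_drop_real a G T m : G \in unitmx -> G^T = G ->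
  T *m G = G *m T^T ->
  T *m a = 0 -> m.+1 != n ->
  (forall u, \sum_(i < m.+1) T ^+ i
     *m ((n%:R / 2) *: (a *m u + adjoint_mx G (a *m u)) - ((u *m a) 0 0)%:M)
     *m T ^+ (m - i) = 0) -> a = 0 \/ T ^+ m = 0.
Proof.
move=> Gu Gs Ts Ta mn E; apply: (power_form0 Gu Gs Ts) => u.
have := leibniz_collapse Gu Gs Ts _ _ (E u) u.
rewrite mulmxA Ta mul0mx scalar_mxC => /(_ erefl erefl).
rewrite -(mulmxA (a *m u)) formMl mul_scalar_mx -scalemxAl formZ.
set s := (u *m a) 0 0; set q := form _ u u => h.
have {h} : (n%:R - m.+1%:R) * (s * q) = 0 by rewrite mulrBl; lra.
by move/eqP; rewrite mulf_eq0 subr_eq0 eqr_nat eq_sym (negbTE mn) => /eqP.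
Qed.

(** The analogue for Q = T^2 - r with r < 0. Differentiating Q ^+ m.+1 = 0
    gives, with P = Q^m,
       a(u) g(T P u, u) + a(T u) g(P u, u) = 0.
    Over the complex numbers this says that the imaginary part of a product
    of a linear and a quadratic form, both eigenvectors for T, vanishes.
    The same identity at T u, where T^2 = r on a and on P, gives the real
    part; together they yield (a(T u)^2 - r a(u)^2) g(P u, u) = 0, where
    the first factor is 0 only if a(u) = 0. *)
Lemma nilpotency_drop_pair a G T m r : G \in unitmx -> G^T = G ->
  T *m G = G *m T^T ->
  r < 0 -> let Q := T *m T - r%:M in
  Q *m a = 0 -> Q ^+ m.+1 = 0 -> m.+1.*2 != n ->
  (forall u, let B := a *m u *m T + T *m a *m u in \sum_(i < m.+1) Q ^+ i
     *m ((n%:R / 2) *: (B + adjoint_mx G B)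
         - ((2 * (u *m a) 0 0) *: T + (2 * (u *m T *m a) 0 0)%:M))
     *m Q ^+ (m - i) = 0) -> a = 0 \/ Q ^+ m = 0.
Proof.
move=> Gu Gs Ts r0 Q Qa Qm mn E.
have Qs : Q *m G = G *m Q^T.
  by rewrite mulmxBl -mulmxA Ts mulmxA Ts linearB /= trmx_mul tr_scalar_mx
    mulmxBr
    mulmxA scalar_mxC.
have TQ : T *m Q = Q *m T by rewrite mulmxBr mulmxBl scalar_mxC mulmxA.
apply: (power_form0 Gu Gs Qs).
set P := Q ^+ m.
have TP : T *m P = P *m T.
  rewrite /P; elim: m {Qm mn E P} => [|k IH];
    first by rewrite expr0 mul1mx mulmx1.
  by rewrite exprSr -mulmxE mulmxA IH -!mulmxA TQ.
pose s u := (u *m a) 0 0; pose D u := form (P *m G) u u.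
pose C u := form (T *m P *m G) u u.
have rel u : s u * C u + s (u *m T) * D u = 0.
  have QB : Q *m (a *m u *m T + T *m a *m u) = 0.
    by rewrite mulmxDr !mulmxA Qa -TQ -(mulmxA T) Qa mulmx0 !mul0mx addr0.
  have ZQ b c : (b *: T + c%:M) *m Q = Q *m (b *: T + c%:M).
    by rewrite mulmxDl [RHS]mulmxDr -scalemxAr -scalemxAl TQ scalar_mxC.
  have := leibniz_collapse Gu Gs Qs QB (ZQ _ _) (E u) u.
  rewrite -/P.
  have -> : (a *m u *m T + T *m a *m u) *m P *m G
      = a *m u *m (T *m P *m G) + T *m a *m u *m (P *m G).
    by rewrite !mulmxDl !mulmxA.
  rewrite formD !formMl mulmxA !mulmxDl mul_scalar_mx -!scalemxAl formD !formZ.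
  rewrite -/(s _) -/(s _) -/(C u) -/(D u) => h.
  have {h} : (n%:R - m.+1.*2%:R) * (s u * C u + s (u *m T) * D u) = 0.
    by rewrite -muln2 natrM; lra.
  by move/eqP; rewrite mulf_eq0 subr_eq0 eqr_nat eq_sym (negbTE mn) => /eqP.
(* On P and on a, where Q vanishes, T acts as a square root of r. *)
have TTP : T *m T *m P = r *: P.
  apply/eqP; rewrite -subr_eq0 -mul_scalar_mx -mulmxBl -/Q.
  by rewrite mulmxE -exprS Qm.
have TTa : T *m T *m a = r *: a.
  by apply/eqP; rewrite -subr_eq0 -mul_scalar_mx -mulmxBl Qa.
have formT S u : form (S *m G) (u *m T) (u *m T) = form (T *m S *m T *m G) u u.
  by rewrite /form trmx_mul -!mulmxA (mulmxA G) -Ts -!mulmxA.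
have DT u : D (u *m T) = r * D u.
  by rewrite /D formT -(mulmxA T) -TP mulmxA TTP -scalemxAl formZ.
have CT u : C (u *m T) = r * C u.
  by rewrite /C formT mulmxA TTP -!scalemxAl formZ TP.
have sTT u : s (u *m T *m T) = r * s u.
  by rewrite /s -(mulmxA u T T) -(mulmxA u) TTa -scalemxAr mxE.
move=> u; rewrite -/(s u) -/(D u).
have e1 := rel u; have := rel (u *m T); rewrite DT CT sTT => e2.
have {}e2 : s (u *m T) * C u + r * s u * D u = 0.
  by apply: (mulfI (negbT (lt_eqF r0))); rewrite mulr0 -[RHS]e2; ring.
(* Eliminate C u from the identities e1 and e2. *)
have : (s (u *m T) ^+ 2 - r * s u ^+ 2) * D u = 0.
  transitivity (s (u *m T) * (s u * C u + s (u *m T) * D u)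
    - s u * (s (u *m T) * C u + r * s u * D u)); first by ring.
  by rewrite e1 e2 !mulr0 subrr.
move/eqP; rewrite mulf_eq0 => /orP[|/eqP->]; last by rewrite mulr0.
rewrite subr_eq0 => /eqP y2.
have : s u ^+ 2 <= 0 by rewrite -(nmulr_rge0 _ r0) -y2 sqr_ge0.
by rewrite exprn_even_le0 //= => /eqP->; rewrite mul0r.
Qed.

End Bilinear.

(** * Ranks of powers of a matrix *)

Section Stable.
Context {F : fieldType} {n : nat}.
Implicit Types X : 'M[F]_n.

Lemma rank_expr_stable X j : \rank (X ^+ j) = \rank (X ^+ j.+1) ->
  (X ^+ j <= X ^+ j.+1)%MS.
Proof.
move=> e; have /mxrank_leqif_sup : (X ^+ j.+1 <= X ^+ j)%MS.
  by rewrite exprS -mulmxE submxMl.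
by move=> /geq_leqif <-; rewrite e.
Qed.

Lemma rank_expr_stableS X j : \rank (X ^+ j) = \rank (X ^+ j.+1) ->
  \rank (X ^+ j.+1) = \rank (X ^+ j.+2).
Proof.
move=> /rank_expr_stable h; apply/eqP; rewrite eqn_leq; apply/andP; split.
  by apply: mxrankS;
    rewrite [X ^+ j.+1]exprSr [X ^+ j.+2]exprSr -mulmxE submxMr.
by apply: mxrankS; rewrite [X ^+ j.+2]exprS -mulmxE submxMl.
Qed.

(** The ranks of the powers of X decrease strictly until they become
    constant. If the kernel of X has dimension at least 2, the kernel of
    X^j has dimension at least j + 1 up to that moment; so a generalized
    eigenspace of dimension at most k is exhausted by the power k.-1. *)
Lemma rank_expr_saturated X k : (2 <= \rank (kermx X))%N ->
  (\rank (kermx (X ^+ k)) <= k)%N -> \rank (X ^+ k.-1) = \rank (X ^+ k).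
Proof.
rewrite !mxrank_ker => X2.
have rS j : (\rank (X ^+ j.+1) <= \rank (X ^+ j))%N.
  by rewrite exprS -mulmxE mxrankM_maxr.
have H j : \rank (X ^+ j.+1) =
  \rank (X ^+ j.+2) \/ (\rank (X ^+ j.+1) + j.+2 <= n)%N.
  elim: j => [|j [/rank_expr_stableS|IH]]; [by right; rewrite expr1;
    lia|by left|].
  have [/esym/rank_expr_stableS|ne] :=
    eqVneq (\rank (X ^+ j.+2)) (\rank (X ^+ j.+1)).
    by left.
  right; have := rS j.+1; lia.
case: k => [//|[|k]] /=; first by rewrite expr1; lia.
case: (H k) => [//|h kk]; have := rS k.+1; lia.
Qed.

End Stable.

(** * Matrices with one eigenvalue or one conjugate pair *)

Section Spectrum.
Context {R : realType}.
Local Notation C := R[i].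

Lemma char_poly_split n (B : 'M[C]_n) : exists zs : seq C,
  [/\ char_poly B = \prod_(z <- zs) ('X - z%:P), size zs = n,
      forall z, (z \in zs) = eigenvalue B z & \tr B = \sum_(z <- zs) z].
Proof.
have [zs zsE] := closed_field_poly_normal (char_poly B).
move: zsE; rewrite (monicP (char_poly_monic B)) scale1r => zsE.
have szs : size zs = n.
  by have := size_char_poly B; rewrite zsE size_prod_XsubC => -[].
exists zs; split => //.
  by move=> z; rewrite eigenvalue_root_char zsE root_prod_XsubC.
case: n B zsE szs => [|n] B zsE szs.
  by rewrite (size0nil szs) big_nil /mxtrace big_ord0.
apply: oppr_inj; rewrite -char_poly_trace // zsE -szs.
by rewrite coefPn_prod_XsubC // szs.
Qed.

Lemma map_mxX (K K' : nzRingType) (f : {rmorphism K -> K'}) n (A : 'M[K]_n) k :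
  map_mx f (A ^+ k) = map_mx f A ^+ k.
Proof.
elim: k => [|k IH]; first by rewrite !expr0 map_mx1.
by rewrite !exprS -!mulmxE map_mxM IH.
Qed.

Lemma nilpotent_trace n (N : 'M[R]_n) m : N ^+ m = 0 -> \tr N = 0.
Proof.
move=> Nm; have [zs [_ _ ev trE]] := char_poly_split (complexify N).
apply: complexI; rewrite -[LHS]trace_map_mx trE big_seq big1 // => z.
rewrite ev => /eigenvalueP[v vN v0]; apply/eqP.
have vX k : v *m complexify N ^+ k = z ^+ k *: v.
  elim: k => [|k IH]; first by rewrite !expr0 scale1r mulmx1.
  by rewrite exprSr -mulmxE mulmxA IH -scalemxAl vN scalerA -exprSr.
have := vX m; rewrite -map_mxX Nm map_mx0 mulmx0 => /esym/eqP.
by rewrite scaler_eq0 (negbTE v0) orbF expf_eq0 => /andP[].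
Qed.

(** Covers both a real eigenvalue z, which is its own conjugate, and a
    pair, for which n is even. *)
Definition spectral_poly n (z : C) : {poly C} :=
  ('X - z%:P) ^+ uphalf n * ('X - (conjc z)%:P) ^+ n./2.

Lemma char_poly_real n (A : 'M[R]_n) z : unique_real_eigenvalue A z ->
  char_poly (complexify A) = ('X - z%:P) ^+ n.
Proof.
move=> [_ uz]; have [zs [-> sz ev _]] := char_poly_split (complexify A).
have /all_pred1P -> : all (pred1 z) zs.
  by apply/allP => w; rewrite ev => /uz /eqP.
by rewrite sz big_nseq iter_mulr_1.
Qed.

Lemma conj_complexify n (A : 'M[R]_n) : map_mx conjc (complexify A) =
  complexify A.
Proof. by apply/matrixP => i j; rewrite !mxE; apply/eqP;
  rewrite eq_complex /= oppr0 !eqxx. Qed.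

(** The characteristic polynomial has real coefficients, so conjugation
    permutes its roots and the two eigenvalues have the same multiplicity. *)
Lemma char_poly_pair n (A : 'M[R]_n) z : unique_complex_pair A z ->
  exists2 k, n = k.*2 &
    char_poly (complexify A) = ('X - z%:P) ^+ k * ('X - (conjc z)%:P) ^+ k.
Proof.
move=> [Iz uz]; have [zs [cE sz ev _]] := char_poly_split (complexify A).
have zz : z != conjc z.
  apply/eqP => e; apply: Iz; have := congr1 (@complex.Im R) e;
    case: (z) => x y /=; lra.
have pc : perm_eq (map conjc zs) zs.
  have := congr1 (map_poly conjc) cE.
  rewrite map_char_poly conj_complexify cE map_prod_XsubC.
  by move=> h; apply: prod_XsubC_eq; rewrite big_map h.
have ct : count_mem z zs = count_mem (conjc z) zs.
  rewrite -(permP pc) count_map; apply: eq_count => w /=.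
  by rewrite (inv_eq (@conjcK R)) conjcK.
have z2 w : w \in zs -> w = z \/ w = conjc z by rewrite ev => /uz.
have cC : count (predC1 z) zs = count_mem (conjc z) zs.
  apply: eq_in_count => w /z2 [|] -> /=; first by rewrite eqxx (negbTE zz).
  by rewrite eqxx eq_sym zz.
exists (count_mem z zs).
  by rewrite -sz -(count_predC (pred1 z)) -[count (predC _) _]/(count (predC1
    z) zs) cC -ct addnn.
rewrite cE (bigID (pred1 z)) /=; congr (_ * _).
  by rewrite (eq_bigr (fun=> 'X - z%:P)) => [|w /eqP->//];
    rewrite big_const_seq iter_mulr_1.
rewrite [in RHS]ct -cC big_seq_cond (eq_bigr (fun=> 'X - (conjc z)%:P)).
  by rewrite -big_seq_cond big_const_seq iter_mulr_1.
by move=> w /andP[/z2[|]-> //]; rewrite eqxx.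
Qed.

Lemma char_poly_spectral n (A : 'M[R]_n) z :
  unique_real_eigenvalue A z \/ unique_complex_pair A z ->
  char_poly (complexify A) = spectral_poly n z.
Proof.
rewrite /spectral_poly => -[h|/char_poly_pair[k nk ->]]; last first.
  by rewrite [in RHS]nk doubleK uphalf_double.
rewrite (char_poly_real h); case: h => Iz _.
have -> : conjc z = z by case: z Iz => x y /= ->; rewrite oppr0.
by rewrite -exprD uphalf_half -addnA addnn odd_double_half.
Qed.

Lemma mxtrace_spectral n (A : 'M[R]_n) z :
  unique_real_eigenvalue A z \/ unique_complex_pair A z ->
  \tr A = n%:R * complex.Re z.
Proof.
move=> /char_poly_spectral;
  have [zs [-> _ _ trE]] := char_poly_split (complexify A).
move=> cE; have : perm_eq zs (nseq (uphalf n) z ++ nseq n./2 (conjc z)).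
  by apply: prod_XsubC_eq; rewrite cE big_cat !big_nseq !iter_mulr_1.
move=> pe; have {trE} : (\tr A)%:C = z *+ uphalf n + conjc z *+ n./2.
  rewrite -[LHS]trace_map_mx trE (perm_big _ pe) big_cat !big_nseq.
  by rewrite -!Monoid.iteropE.
move=> /(congr1 (@complex.Re R)) /= ->.
rewrite raddfD /= !raddfMn /=.
by case: (z) => x y /=;
  rewrite -mulrnDr uphalf_half -addnA addnn odd_double_half mulr_natl.
Qed.

Lemma complexifyB n (A B : 'M[R]_n) : complexify (A - B) =
  complexify A - complexify B.
Proof. exact: map_mxB. Qed.

Lemma complexify_eq0 n (A : 'M[R]_n) : (complexify A == 0) = (A == 0).
Proof. exact: map_mx_eq0. Qed.

(** The power n vanishes by Cayley-Hamilton; the second eigenvector saves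
    one. *)
Lemma nilpotent_real n (A : 'M[R]_n) z : unique_real_eigenvalue A z ->
  (2 <= geometric_multiplicity A z)%N -> (A - (complex.Re z)%:M) ^+ n.-1 = 0.
Proof.
move=> uA; have := uA => -[Iz _]; rewrite /geometric_multiplicity Iz eqxx => r2.
have zE : z = (complex.Re z)%:C by case: (z) Iz => x y /= ->.
case: n A uA r2 => [|n] A uA r2;
  first by have := rank_leq_row (eigenspace A (complex.Re z)); lia.
set X := A - _; have Xn : X ^+ n.+1 = 0.
  apply/eqP;
    rewrite -complexify_eq0 /complexify map_mxX map_mxB map_scalar_mx /=.
  have := Cayley_Hamilton (complexify A); rewrite (char_poly_real uA).
  by rewrite rmorphXn rmorphB /= horner_mx_X horner_mx_C {1}zE => ->.
apply/eqP;
  rewrite -mxrank_eq0 (@rank_expr_saturated _ _ _ n.+1) ?Xn ?mxrank0 //.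
exact: rank_leq_row.
Qed.

(** With X = A - z and Y = A - conj z, the matrix T^2 + (Im z)^2 is X Y.
    The generalized eigenspaces of z and of its conjugate are disjoint and
    of the same dimension k.+1 = n / 2, so by rank_expr_saturated X^k is
    already a left multiple of X^(k+1). Hence X^k Y^(k+1) = 0 and, by
    conjugation, X^(k+1) Y^k = 0; the difference of the two is a nonzero
    multiple of X^k Y^k. *)
Lemma nilpotent_pair n (A : 'M[R]_n) z : unique_complex_pair A z ->
  (2 <= geometric_multiplicity A z)%N ->
  exists2 k, n = k.+1.*2 &
    let T := A - (complex.Re z)%:M in
    (T *m T - (- complex.Im z ^+ 2)%:M) ^+ k = 0.
Proof.
move=> uA; have := uA => -[/eqP Iz _].
rewrite /geometric_multiplicity (negbTE Iz) /eigenspace => r2.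
have [k nk cE] := char_poly_pair uA.
case: n A uA r2 nk cE => [|n] A uA r2 nk cE.
  by move: r2; set K := kermx _; have := rank_leq_row K; lia.
case: k nk cE => [//|k] nk cE; exists k => //; set T := A - _.
pose B := complexify A; pose X := B - z%:M; pose Y := B - (conjc z)%:M.
have hX w j : horner_mx B (('X - w%:P) ^+ j) = (B - w%:M) ^+ j.
  by rewrite rmorphXn rmorphB /= horner_mx_X horner_mx_C.
have cX j : map_mx conjc (X ^+ j) = Y ^+ j.
  by rewrite map_mxX map_mxB map_scalar_mx conj_complexify.
have cY j : map_mx conjc (Y ^+ j) = X ^+ j.
  by rewrite map_mxX map_mxB map_scalar_mx conj_complexify /= conjcK.
have zz : z - conjc z != 0.
  rewrite subr_eq0; apply/eqP => e; move/eqP: Iz; apply.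
  have := congr1 (@complex.Im R) e; case: (z) => x y /=; lra.
have XY0 : X ^+ k.+1 *m Y ^+ k.+1 = 0.
  by have := Cayley_Hamilton B; rewrite cE rmorphM /= !hX.
(* Twice this dimension is at most n = 2 (k + 1). *)
have rk : (\rank (kermx (X ^+ k.+1)) <= k.+1)%N.
  have rY : \rank (kermx (Y ^+ k.+1)) = \rank (kermx (X ^+ k.+1)).
    by rewrite -cX -map_kermx mxrank_map.
  have /mxdirect_kermxpoly : coprimep (('X - z%:P) ^+ k.+1) (('X - (conjc
    z)%:P) ^+ k.+1).
    by rewrite coprimep_expl // coprimep_expr // coprimep_XsubC root_XsubC
      eq_sym -subr_eq0.
  move=> /(_ _ B); rewrite /kermxpoly !hX => /mxrank_disjoint_sum.
  have := rank_leq_col (kermx (X ^+ k.+1) + kermx (Y ^+ k.+1))%MS.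
  rewrite -/X -/Y; lia.
have /submxP[Z ZE] : (X ^+ k <= X ^+ k.+1)%MS.
  by apply: rank_expr_stable; rewrite -(rank_expr_saturated r2 rk).
have XkY : X ^+ k *m Y ^+ k.+1 = 0 by rewrite ZE -mulmxA XY0 mulmx0.
have YkX : Y ^+ k *m X ^+ k.+1 = 0.
  by rewrite -cX -[X in _ *m X]cY -map_mxM XkY map_mx0.
pose w : C := 'i * (complex.Im z)%:C; pose TC := complexify T.
have XE : X = TC - w%:M.
  rewrite /X /TC /T complexifyB /complexify map_scalar_mx -/(complexify A) -/B.
  by rewrite {1}(complexE z) raddfD opprD addrA.
have YE : Y = TC + w%:M.
  rewrite /Y /TC /T complexifyB /complexify map_scalar_mx -/(complexify A) -/B.
  have -> : conjc z = (complex.Re z)%:C - w.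
    by rewrite /w; case: (z) => x y /=; apply/eqP; rewrite eq_complex /=;
      apply/andP; split; apply/eqP; ring.
  by rewrite raddfB opprB addrA addrAC.
have TT : complexify (T *m T - (- complex.Im z ^+ 2)%:M) = X *m Y.
  rewrite complexifyB {1}/complexify map_mxM /complexify map_scalar_mx
    -/(complexify T) -/TC.
  rewrite XE YE mulmxBl !mulmxDr opprD addrA scalar_mxC addrK -scalar_mxM.
  congr (_ - _%:M); rewrite /w /=.
  by apply/eqP; rewrite eq_complex /=; apply/andP; split; apply/eqP; ring.
have XYc : Y *m X = X *m Y.
  by rewrite XE YE mulmxDl !mulmxBr mulmxBl !mulmxDr scalar_mxC opprD !addrA
    addrK subrK.
apply/eqP; rewrite -complexify_eq0 /complexify map_mxX -/(complexify _) TT.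
have -> : (X *m Y) ^+ k =
  X ^+ k *m Y ^+ k by rewrite mulmxE exprMn_comm // /GRing.comm -mulmxE.
have : X ^+ k *m Y ^+ k *m (z - conjc z)%:M = 0; last first.
  by move/eqP; rewrite mul_mx_scalar scaler_eq0 (negbTE zz).
have cXY : X ^+ k *m Y ^+ k = Y ^+ k *m X ^+ k.
  by apply: commrX; apply/commr_sym/commrX.
have -> : (z - conjc z)%:M =
  Y - X by rewrite raddfB /Y /X opprB [RHS]addrC subrKA.
rewrite mulmxBr {2}cXY -!mulmxA !mulmxE -!exprSr -!mulmxE XkY YkX.
by rewrite subrr.
Qed.

End Spectrum.

(** * Differential calculus of matrix-valued functions *)

Section MatrixCalculus.
Context {R : realType} {V : normedModType R}.

Lemma is_derive_mxP m p (F : V -> 'M[R]_(m, p)) x v dF :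
  is_derive x v F dF <-> forall i j, is_derive x v (fun y => F y i j) (dF i j).
Proof.
split=> [[Fx <-] i j|h].
  split; first by have /derivable_mxP := Fx.
  by rewrite derive_mx // mxE.
have Fx : derivable F x v by apply/derivable_mxP => i j; have [] := h i j.
split=> //; rewrite derive_mx //; apply/matrixP => i j; rewrite mxE.
by have [] := h i j.
Qed.

Lemma is_derive_mulmx m p q (F : V -> 'M[R]_(m, p)) (H : V ->
  'M[R]_(p, q)) x v dF dH :
  is_derive x v F dF -> is_derive x v H dH ->
  is_derive x v (fun y => F y *m H y) (dF *m H x + F x *m dH).
Proof.
move=> /is_derive_mxP dFx /is_derive_mxP dHx; apply/is_derive_mxP => i j.
have -> : (fun y => (F y *m H y) i j) =
  \sum_k ((fun y => F y i k) * (fun y => H y k j)).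
  by apply/funext => y; rewrite mxE fct_sumE.
rewrite !mxE -big_split /=; apply: is_derive_sum => k.
rewrite addrC [dF i k * _]mulrC.
exact: (is_deriveM (dFx i k) (dHx k j)).
Qed.

Lemma differentiable_mxP m p (F : V -> 'M[R]_(m, p)) x :
  differentiable F x <-> forall i j, differentiable (fun y => F y i j) x.
Proof.
split=> [dF i j|dF].
  by apply: (@differentiable_comp _ _ _ _ F (fun A : 'M[R]_(m, p) => A i j)) =>
    //; exact: differentiable_coord.
have -> : F = \sum_i \sum_j (fun y => F y i j *: delta_mx i j).
  apply/funext => y; rewrite [LHS]matrix_sum_delta fct_sumE.
  by apply: eq_bigr => i _; rewrite fct_sumE.
apply: differentiable_sum => i; apply: differentiable_sum => j.
exact: differentiableZl.
Qed.

Lemma differentiable_mulmx m p q (F : V -> 'M[R]_(m, p)) (H : V ->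
  'M[R]_(p, q)) x :
  differentiable F x -> differentiable H x ->
    differentiable (fun y => F y *m H y) x.
Proof.
move=> /differentiable_mxP dF /differentiable_mxP dH;
  apply/differentiable_mxP => i j.
have -> : (fun y => (F y *m H y) i j) =
  \sum_k ((fun y => F y i k) * (fun y => H y k j)).
  by apply/funext => y; rewrite mxE fct_sumE.
by apply: differentiable_sum => k; apply: differentiableM.
Qed.

End MatrixCalculus.

Section SmoothOn.
Context {R : realType} {n : nat}.
Implicit Types A : set 'rV[R]_n.

Lemma Ck_on_subset (V : normedModType R) k A A' (f : 'rV[R]_n -> V) :
  A' `<=` A -> Ck_on k A f -> Ck_on k A' f.
Proof.
move=> AA'; elim: k f => [|k IH] f /=; first by move=> h x /AA'; exact: h.
by move=> [d D]; split=> [x /AA'|u]; [exact: d|exact: IH].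
Qed.

(** Coordinate expressions are total functions, meaningful on an open set
    only; so differentiability has to pass between functions that agree
    near a point. *)
Lemma near_eq_differentiable (V W : normedModType R) (f h : V -> W) x :
  (\near x, f x = h x) -> differentiable f x -> differentiable h x.
Proof.
move=> fh df; have fhx : f x = h x := nbhs_singleton fh.
have hE : h \o shift x = cst (h x) + 'd f x +o_ 0 id.
  have /eqaddoP fE := diff_locally df; apply/eqaddoP => e e0.
  have fh0 : \forall y \near (0 : V), f (y + x) = h (y + x).
    by have := fh; rewrite (near_shift 0 x) subr0.
  apply: filterS2 fh0 (fE e e0) => y fhy.
  by rewrite /= !fctE /= fhy fhx.
have dE := diff_unique (diff_continuous df) hE.
by apply/diff_locallyP; rewrite dE; split=> //; exact: diff_continuous.
Qed.

Lemma open_near A (P : 'rV[R]_n -> Prop) x : open A -> A x ->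
  (forall y, A y -> P y) -> \near x, P x.
Proof.
by move=> oA Ax h; near=> y; apply: h; near: y; exact: open_nbhs_nbhs.
Unshelve. all: by end_near. Qed.

Lemma Ck_on_eq (V : normedModType R) k A (f h : 'rV[R]_n -> V) : open A ->
  (forall x, A x -> f x = h x) -> Ck_on k A f -> Ck_on k A h.
Proof.
move=> oA; elim: k f h => [|k IH] f h fh.
  move=> c x Ax; have fc : f y @[y --> x] --> f x := c x Ax.
  change (h y @[y --> x] --> h x); rewrite -(fh x Ax).
  have fhx : {near x, f =1 h} by exact: open_near oA Ax fh.
  exact: (cvg_trans (near_eq_cvg fhx) fc).
move=> [d D]; split=> [x Ax|u].
  exact: near_eq_differentiable (open_near oA Ax fh) (d x Ax).
apply: IH (D u) => x Ax.
exact: near_eq_derive (open_near oA Ax fh).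
Qed.

Lemma smooth_derive (V : normedModType R) A (f : 'rV[R]_n -> V) u :
  smooth_on A f -> smooth_on A (fun x => 'D_u f x).
Proof. by move=> sf k; have [_ D] := sf k.+1; exact: D. Qed.

Lemma smooth_differentiable (V : normedModType R) A (f : 'rV[R]_n -> V) x :
  smooth_on A f -> A x -> differentiable f x.
Proof. by move=> /(_ 1)[d _]; exact: d. Qed.

Lemma smooth_eq (V : normedModType R) A (f h : 'rV[R]_n -> V) : open A ->
  (forall x, A x -> f x = h x) -> smooth_on A f -> smooth_on A h.
Proof. by move=> oA fh sf k; apply: Ck_on_eq fh (sf k). Qed.

Lemma smooth_subset (V : normedModType R) A A' (f : 'rV[R]_n -> V) :
  A' `<=` A -> smooth_on A f -> smooth_on A' f.
Proof. by move=> AA' sf k; exact: Ck_on_subset AA' (sf k). Qed.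

Lemma smooth_cst (V : normedModType R) A (a : V) : smooth_on A (fun _ => a).
Proof.
move=> k; elim: k a => [|k IH] a /=; first by move=> x _; exact: cst_continuous.
split=> [x _|u]; first exact: differentiable_cst.
have -> : (fun x => 'D_u (fun _ : 'rV[R]_n => a) x) = fun=> 0.
  by apply/funext => x; rewrite derive_cst.
exact: IH.
Qed.

Lemma Ck_onD (V : normedModType R) k A (f h : 'rV[R]_n -> V) : open A ->
  Ck_on k A f -> Ck_on k A h -> Ck_on k A (fun x => f x + h x).
Proof.
move=> oA; elim: k f h => [|k IH] f h /=.
  by move=> cf ch x Ax; apply: continuousD; [exact: cf|exact: ch].
move=> [df Df] [dh Dh]; split=> [x Ax|u].
  by apply: differentiableD; [exact: df|exact: dh].
apply: Ck_on_eq oA _ (IH _ _ (Df u) (Dh u)) => x Ax /=.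
by rewrite -deriveD //; apply: diff_derivable; [exact: df|exact: dh].
Qed.

Lemma smoothD (V : normedModType R) A (f h : 'rV[R]_n -> V) : open A ->
  smooth_on A f -> smooth_on A h -> smooth_on A (fun x => f x + h x).
Proof. by move=> oA sf sh k; apply: Ck_onD. Qed.

(** The induction needs smooth factors: the derivative of order k of a
    product involves derivatives of the factors of all lower orders. *)
Lemma smooth_mulmx m p q A (f : 'rV[R]_n -> 'M[R]_(m, p))
    (h : 'rV[R]_n -> 'M[R]_(p, q)) :
  open A -> smooth_on A f -> smooth_on A h -> smooth_on A (fun x => f x *m h x).
Proof.
move=> oA + + k; elim: k f h => [|k IH] f h sf sh /=.
  move=> x Ax; apply: differentiable_continuous.
  by apply: differentiable_mulmx; apply: smooth_differentiable Ax.
split=> [x Ax|u].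
  by apply: differentiable_mulmx; apply: smooth_differentiable Ax.
apply: Ck_on_eq oA _ (Ck_onD oA (IH _ _ (smooth_derive u sf) sh)
  (IH _ _ sf (smooth_derive u sh))) => x Ax /=.
have df : is_derive x u f ('D_u f x).
  by apply: derivableP; apply: diff_derivable; apply: smooth_differentiable Ax.
have dh : is_derive x u h ('D_u h x).
  by apply: derivableP; apply: diff_derivable; apply: smooth_differentiable Ax.
by have [_ ->] := is_derive_mulmx df dh.
Qed.

Lemma smooth_horner_mx m A (f : 'rV[R]_n -> 'M[R]_m.+1) (p : {poly R}) :
  open A -> smooth_on A f -> smooth_on A (fun x => horner_mx (f x) p).
Proof.
move=> oA sf; elim/poly_ind: p => [|p c IH].
  have -> : (fun x => horner_mx (f x) 0) = fun=> 0.
    by apply/funext => x; rewrite rmorph0.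
  exact: smooth_cst.
have -> : (fun x => horner_mx (f x) (p * 'X + c%:P))
    = (fun x => horner_mx (f x) p *m f x + c%:M).
  by apply/funext => x; rewrite rmorphD rmorphM /= horner_mx_X horner_mx_C.
by apply: smoothD => //; [exact: smooth_mulmx|exact: smooth_cst].
Qed.

End SmoothOn.

(** * Adjoints and traces *)

Section Adjoint.
Context {R : realType} {n : nat}.
Implicit Types (G A B T X : 'M[R]_n) (a : 'cV[R]_n) (u : 'rV[R]_n).

Lemma adjoint_mx_id G T : G \in unitmx -> T *m G = G *m T^T ->
  adjoint_mx G T = T.
Proof.
by move=> Gu Ts; rewrite /adjoint_mx -mulmxA Ts mulmxA mulVmx // mul1mx trmxK.
Qed.

Lemma adjoint_mx_mul G A B : G \in unitmx ->
  adjoint_mx G (A *m B) = adjoint_mx G B *m adjoint_mx G A.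
Proof.
by move=> Gu; rewrite /adjoint_mx -trmx_mul !mulmxA mulmxK.
Qed.

Lemma adjoint_mxD G A B : adjoint_mx G (A + B) =
  adjoint_mx G A + adjoint_mx G B.
Proof. by rewrite /adjoint_mx mulmxDr mulmxDl linearD. Qed.

Lemma mxtrace_adjoint G A : G \in unitmx -> \tr (adjoint_mx G A) = \tr A.
Proof. by move=> Gu; rewrite /adjoint_mx mxtrace_tr mxtrace_mulC mulKVmx. Qed.

Lemma mxtrace_mul_adjoint G X A : G \in unitmx -> X *m G = G *m X^T ->
  \tr (X *m adjoint_mx G A) = \tr (X *m A).
Proof.
move=> Gu Xs; rewrite mxtrace_mulC -{1}(adjoint_mx_id Gu Xs) -adjoint_mx_mul //.
exact: mxtrace_adjoint.
Qed.

Lemma mxtrace_rank1 X a u : \tr (X *m (a *m u)) = (u *m X *m a) 0 0.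
Proof. by rewrite mulmxA mxtrace_mulC mulmxA [LHS]big_ord1. Qed.

Lemma covector0 a : (forall u, (u *m a) 0 0 = 0) -> a = 0.
Proof.
move=> h; apply/matrixP => i j; rewrite ord1 mxE.
by have := h (delta_mx 0 i); rewrite -rowE mxE.
Qed.

Lemma mxtraceB A B : \tr (A - B) = \tr A - \tr B.
Proof. exact: raddfB. Qed.

End Adjoint.

(** * Covariant derivatives of endomorphism fields *)

Section CovariantDerivative.
Context {R : realType} {n : nat}.
Implicit Types (C E : 'M[R]_n) (y u : 'rV[R]_n) (F H : 'rV[R]_n -> 'M[R]_n).

(** The matrix E is the covariant derivative of the endomorphism field F at
    y in the direction u, for the connection matrix C: E = D_u F + F C - C
    F. *)
Definition is_nabla C y u F E : Prop :=
  is_derive y u F (E + C *m F y - F y *m C).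

(** The connection matrix C acts by a commutator, which is a derivation. *)
Lemma is_nabla_mul C y u F H E E' : is_nabla C y u F E -> is_nabla C y u H E' ->
  is_nabla C y u (fun z => F z *m H z) (E *m H y + F y *m E').
Proof.
move=> dF dH; have := is_derive_mulmx dF dH; rewrite /is_nabla.
congr is_derive; rewrite !(mulmxDl, mulmxDr) !mulNmx !mulmxN !mulmxA.
by rewrite !addrA; congr (_ - _); rewrite addrAC subrK addrAC.
Qed.

Lemma is_nablaX C y u F E m : is_nabla C y u F E ->
  is_nabla C y u (fun z => F z ^+ m.+1)
    (\sum_(i < m.+1) F y ^+ i *m E *m F y ^+ (m - i)).
Proof.
move=> dF; elim: m => [|m IH].
  by rewrite big_ord1 subn0 !expr0 mulmx1 mul1mx.
rewrite big_ord_recr /= subnn expr0 mulmx1; have := is_nabla_mul IH dF.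
have -> : (fun z => F z ^+ m.+1 *m F z) = (fun z => F z ^+ m.+2).
  by apply/funext => z; rewrite [RHS]exprSr.
congr is_nabla; congr (_ + _); rewrite mulmx_suml; apply: eq_bigr => i _.
rewrite subSn; last by rewrite -ltnS.
by rewrite exprSr -mulmxE !mulmxA.
Qed.

Lemma is_nablaD C y u F H E E' : is_nabla C y u F E -> is_nabla C y u H E' ->
  is_nabla C y u (fun z => F z + H z) (E + E').
Proof.
move=> dF dH; have := is_deriveD dF dH; rewrite /is_nabla.
congr is_derive; rewrite mulmxDl mulmxDr opprD !addrA; congr (_ - _).
by rewrite -!addrA; congr (_ + _); rewrite addrCA addrC -!addrA addrCA.
Qed.

Lemma is_nabla_scalar C y u (s : 'rV[R]_n -> R) ds : is_derive y u s ds ->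
  is_nabla C y u (fun z => (s z)%:M) ds%:M.
Proof.
move=> d; rewrite /is_nabla scalar_mxC addrK; apply/is_derive_mxP => i j.
rewrite mxE; have -> : (fun z => (s z)%:M i j) = (fun z => (i == j)%:R * s z).
  by apply/funext => z; rewrite mxE mulr_natl.
by rewrite -[ds *+ _]mulr_natl; exact: (is_deriveZ (i == j)%:R d).
Qed.

Lemma is_derive_trace y u F E : is_derive y u F E ->
  is_derive y u (fun z => \tr (F z)) (\tr E).
Proof.
move=> /is_derive_mxP d.
have -> : (fun z => \tr (F z)) = \sum_i (fun z => F z i i).
  by apply/funext => z; rewrite fct_sumE.
exact: is_derive_sum.
Qed.

(** A commutator has trace 0, so that the trace does not see the
    connection. *)
Lemma is_nabla_trace C y u F E : is_nabla C y u F E ->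
  is_derive y u (fun z => \tr (F z)) (\tr E).
Proof.
move=> /is_derive_trace; congr is_derive.
by rewrite mxtraceB mxtraceD [X in _ - X]mxtrace_mulC addrK.
Qed.

Lemma is_derive_near_cst (W : normedModType R) y u (f : 'rV[R]_n -> W) a df :
  (\near y, f y = a) -> is_derive y u f df -> df = 0.
Proof.
move=> fa d; have := near_eq_is_derive fa d => -[_ <-].
exact: derive_cst.
Qed.

Lemma is_nabla_near0 C y u F E : (\near y, F y = 0) ->
  is_nabla C y u F E -> E = 0.
Proof.
move=> F0 /(is_derive_near_cst F0).
by rewrite (nbhs_singleton F0) mulmx0 mul0mx subr0 addr0.
Qed.

End CovariantDerivative.

Lemma open_neq0 (R : realType) (V : normedModType R) : open [set w : V | w !=
  0].
Proof.
have -> : [set w : V | w != 0] = ~` [set 0].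
  by apply/seteqP; split=> w /=; [move/eqP|move/eqP].
apply: closed_openC; apply: accessible_closed_set1.
exact/hausdorff_accessible/norm_hausdorff.
Qed.

(** * Compatible fields on a coordinate domain: the trace is constant *)

Section LocalCompatible.
Context {R : realType} {n : nat}.
Context (G : 'rV[R]_n -> 'M[R]_n) (C : 'rV[R]_n -> 'rV[R]_n -> 'M[R]_n)
  (L : 'rV[R]_n -> 'M[R]_n) (t : 'rV[R]_n -> 'cV[R]_n).
Implicit Types (W : set 'rV[R]_n) (y u : 'rV[R]_n).

(** Compatibility in a coordinate domain; t stands for dtr L, a covector. *)
Definition compatible_at y : Prop :=
  [/\ G y \in unitmx, (G y)^T = G y, L y *m G y = G y *m (L y)^T &
      forall u, let A := t y *m u in
        is_nabla (C y u) y u L (2^-1 *: (A + adjoint_mx (G y) A))].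

Definition trace_free y : 'M[R]_n := L y - (n%:R^-1 * \tr (L y))%:M.
Local Notation T := trace_free.
Local Notation a y := (n%:R^-1 *: t y).

Context (n0 : (0 < n)%N).
Let nR : n%:R != 0 :> R. Proof. by rewrite pnatr_eq0 -lt0n. Qed.

Lemma mxtrace_trace_free y : \tr (T y) = 0.
Proof.
by rewrite /T mxtraceB mxtrace_scalar -[X in _ - X]mulr_natl mulrA mulfV //
  mul1r subrr.
Qed.

Lemma trace_free_selfadjoint y : compatible_at y ->
  T y *m G y = G y *m (T y)^T.
Proof.
case=> _ _ Ls _; rewrite /T mulmxBl Ls linearB /= tr_scalar_mx mulmxBr.
by rewrite scalar_mxC.
Qed.

Lemma is_derive_trL y u : compatible_at y ->
  is_derive y u (fun z => \tr (L z)) ((u *m t y) 0 0).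
Proof.
case=> Gu _ _ /(_ u) /is_nabla_trace.
rewrite mxtraceZ mxtraceD mxtrace_adjoint // mulrDr ![2^-1 * _]mulrC -splitr.
by rewrite -[X in \tr X](mul1mx (t y *m u)) mxtrace_rank1 mulmx1.
Qed.

Definition nabla_trace_free y u : 'M[R]_n :=
  let A := a y *m u in
  (n%:R / 2) *: (A + adjoint_mx (G y) A) - ((u *m a y) 0 0)%:M.

Lemma is_nabla_of_trace_free y u : compatible_at y ->
  is_nabla (C y u) y u T (nabla_trace_free y u).
Proof.
move=> cy; have [_ _ _ /(_ u) cL] := cy.
have dtr : is_derive y u (fun z => - (n%:R^-1 * \tr (L z))) (- (u *m a y) 0 0).
  apply: is_deriveN; rewrite -scalemxAr mxE.
  exact: (is_deriveZ n%:R^-1 (is_derive_trL u cy)).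
have := is_nablaD cL (is_nabla_scalar (C y u) dtr).
have -> : (fun z => L z + (- (n%:R^-1 * \tr (L z)))%:M) = T.
  by apply/funext => z; rewrite raddfN.
congr is_nabla; rewrite raddfN /nabla_trace_free; congr (_ - _).
rewrite -!scalemxAl /adjoint_mx -scalemxAr -scalemxAl linearZ /= -scalerDr
  scalerA.
by congr (_ *: _); field.
Qed.

(** Taking X = T^(k-1), this computes the derivative of tr T^k up to the
    factor k, so that a constant tr T^k becomes a linear equation for dtr
    L. *)
Lemma mxtrace_mul_nabla y u X : compatible_at y -> X *m G y = G y *m X^T ->
  \tr (X *m nabla_trace_free y u) =
    n%:R * (u *m X *m a y) 0 0 - (u *m a y) 0 0 * \tr X.
Proof.
case=> Gu _ _ _ Xs.
rewrite /nabla_trace_free mulmxBr mxtraceB -scalemxAr mxtraceZ mulmxDr mxtraceD.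
rewrite mxtrace_mul_adjoint // mxtrace_rank1 mul_mx_scalar mxtraceZ.
by congr (_ - _); field.
Qed.

(** An induction on m that uses every open subset: where t is not 0, the
    step lowers m; the set of such points is open, so the induction
    hypothesis applies to it and says that it is empty. *)
Lemma nilpotency_descent (Q : 'rV[R]_n -> 'M[R]_n) m W : open W ->
  (forall y, W y -> {for y, continuous t}) ->
  (forall k W', (k < m)%N -> open W' -> W' `<=` W ->
    (forall z, W' z -> Q z ^+ k.+1 = 0) ->
    forall z, W' z -> t z = 0 \/ Q z ^+ k = 0) ->
  (forall y, W y -> Q y ^+ m = 0) -> forall y, W y -> t y = 0.
Proof.
move=> + + + + y; elim: m W y => [|m IH] W y oW ct step Qm Wy.
  have /matrixP/(_ (Ordinal n0) (Ordinal n0)) := Qm y Wy.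
  by rewrite expr0 !mxE eqxx => /eqP; rewrite oner_eq0.
apply/eqP/negPn/negP => ty.
pose W' := W `&` [set z | t z != 0].
have oW' : open W'.
  rewrite openE => z [Wz tz]; apply: filterI; first exact: open_nbhs_nbhs.
  have : nbhs (t z) [set w | w != 0].
    by apply: open_nbhs_nbhs; split=> //; apply: (@open_neq0).
  exact: ct.
suff : t y = 0 by move/eqP: ty.
apply: (IH W' y) => //.
- by move=> z [/ct].
- move=> k V km oV VW' Qk z Vz.
  by apply: (step k V) => //; [exact: leqW | move=> w /VW'[]].
move=> z [Wz tz].
by have [/eqP|//] := step m W (ltnSn m) oW (fun _ => id) Qm z Wz;
  rewrite (negbTE tz).
Qed.

(** As T is nilpotent, tr T^2 = 0; its derivative says that T kills the
    covector t / n, which is what nilpotency_drop_real needs. *)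
Theorem constant_trace_real m W : open W -> (m < n)%N ->
  (forall y, W y -> compatible_at y) -> (forall y, W y ->
    {for y, continuous t}) ->
  (forall y, W y -> T y ^+ m = 0) -> forall y, W y -> t y = 0.
Proof.
move=> oW mn cW ct; apply: nilpotency_descent => // k V km oV VW Tk z Vz.
have cz := cW z (VW z Vz); have [Gu Gs _ _] := cz.
have Ts := trace_free_selfadjoint cz.
have cT u := is_nabla_of_trace_free u cz.
have Ta : T z *m a z = 0.
  apply: covector0 => u.
  have : \near z, \tr (T z *m T z) = 0.
    apply: (open_near oV Vz) => w Vw; apply: (@nilpotent_trace _ _ _ k.+1).
    by rewrite mulmxE -expr2 exprAC Tk // expr2 mulr0.
  move=> /is_derive_near_cst/(_ (is_nabla_trace (is_nabla_mul (cT u) (cT u)))).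
  rewrite mxtraceD mxtrace_mulC -mulr2n mxtrace_mul_nabla // mxtrace_trace_free.
  rewrite mulr0 subr0 mulmxA => /eqP; rewrite mulrn_eq0 mulf_eq0 (negbTE nR) /=.
  by move/eqP.
case: (@nilpotency_drop_real _ _ (a z) (G z) (T z) k Gu Gs Ts Ta) => //.
- by rewrite ltn_eqF // (leq_ltn_trans km).
- by move=> u; apply: is_nabla_near0 (is_nablaX k (cT u));
  apply: (open_near oV Vz).
- by move/eqP; rewrite scaler_eq0 invr_eq0 (negbTE nR) => /eqP; left.
by right.
Qed.

(** If L y has one eigenvalue, or one conjugate pair, this is minus the
    square of the imaginary part. *)
Definition square_trace y : R := n%:R^-1 * \tr (T y *m T y).
Local Notation r := square_trace.

Lemma is_derive_square_trace y u : compatible_at y ->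
  is_derive y u r (2 * (u *m T y *m a y) 0 0).
Proof.
move=> cy; have cT := is_nabla_of_trace_free u cy.
have := is_deriveZ n%:R^-1 (is_nabla_trace (is_nabla_mul cT cT)).
congr is_derive; rewrite mxtraceD mxtrace_mulC -mulr2n mxtrace_mul_nabla //.
  rewrite mxtrace_trace_free mulr0 subr0 -[LHS]/(_^-1 * _) mulrnAr mulKf //.
  by rewrite mulr_natl.
exact: trace_free_selfadjoint.
Qed.

(** As T (T^2 - r) is nilpotent and tr T = 0, also tr T^3 = 0; its
    derivative says that T^2 - r kills t / n. *)
Theorem constant_trace_pair m W : open W -> (m.*2 < n)%N ->
  (forall y, W y -> compatible_at y) -> (forall y, W y ->
    {for y, continuous t}) ->
  (forall y, W y -> r y < 0) ->
  (forall y, W y -> (T y *m T y - (r y)%:M) ^+ m = 0) ->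
  forall y, W y -> t y = 0.
Proof.
move=> oW mn cW ct r0.
apply: (@nilpotency_descent (fun y => T y *m T y - (r y)%:M)) => // k V km oV
  VW Qk z Vz.
have cz := cW z (VW z Vz); have [Gu Gs _ _] := cz.
have Ts := trace_free_selfadjoint cz.
have cT u := is_nabla_of_trace_free u cz.
have TTs : (T z *m T z) *m G z = G z *m (T z *m T z)^T.
  by rewrite -mulmxA Ts mulmxA Ts trmx_mul mulmxA.
have cube (X : 'M[R]_n) s : X *m X *m X = (X *m X - s%:M) *m X + s *: X.
  by rewrite mulmxBl mul_scalar_mx subrK.
have square_comm (X : 'M[R]_n) s : (X *m X - s%:M) *m X = X *m (X *m X - s%:M).
  by rewrite mulmxBl mulmxBr mulmxA scalar_mxC.
have anticomm (S S' X : 'M[R]_n) s c :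
    (c *: (S + S') - s%:M) *m X + X *m (c *: (S + S') - s%:M)
      = c *: (S *m X + X *m S + (X *m S' + S' *m X)) - (2 * s) *: X.
  rewrite mulmxBl mulmxBr -scalemxAl -scalemxAr mulmxDl mulmxDr.
  rewrite mul_scalar_mx mul_mx_scalar addrACA -opprD -scalerDl -scalerDr.
  congr (_ *: _ - _ *: _); last by ring.
  by rewrite addrACA [S' *m X + _]addrC.
have Qa : (T z *m T z - (r z)%:M) *m a z = 0.
  apply: covector0 => u.
  have : \near z, \tr (T z *m T z *m T z) = 0.
    apply: (open_near oV Vz) => w Vw.
    rewrite (cube _ (r w)) mxtraceD mxtraceZ mxtrace_trace_free mulr0 addr0.
    apply: (@nilpotent_trace _ _ _ k.+1); rewrite mulmxE exprMn_comm;
      last first.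
      exact: square_comm.
    by rewrite Qk // mul0r.
  move=> /is_derive_near_cst/(_ (is_nabla_trace (is_nabla_mul (is_nabla_mul (cT
    u) (cT u)) (cT u)))).
  have -> : \tr ((nabla_trace_free z u *m T z + T z *m nabla_trace_free z u) *m
    T z + T z *m T z *m nabla_trace_free z u)
     = 3 * \tr (T z *m T z *m nabla_trace_free z u).
    rewrite mulmxDl !mxtraceD -(mulmxA (nabla_trace_free z u)) (mxtrace_mulC
      (nabla_trace_free z u)).
    by rewrite (mxtrace_mulC (T z *m nabla_trace_free z u)) mulmxA; ring.
  rewrite mxtrace_mul_nabla // => /eqP; rewrite mulf_eq0 pnatr_eq0 /= => /eqP h.
  have -> : (u *m ((T z *m T z - (r z)%:M) *m a z)) 0 0
      = (u *m (T z *m T z) *m a z) 0 0 - r z * (u *m a z) 0 0.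
    rewrite mulmxA mulmxBr mulmxBl mul_mx_scalar -[in X in _ - X]scalemxAl.
    by rewrite [LHS]mxE [X in _ + X]mxE [in X in _ - X]mxE.
  apply: (mulfI nR); rewrite mulr0 -[RHS]h mulrBr; congr (_ - _).
  by rewrite /r !mulrA mulfV // mul1r mulrC.
have := @nilpotency_drop_pair _ _ (a z) (G z) (T z) k (r z) Gu Gs Ts (r0 z (VW
  z Vz)) Qa (Qk z Vz).
case.
- by rewrite ltn_eqF // (leq_ltn_trans _ mn) // leq_double.
- move=> u B; have cQ : is_nabla (C z u) z u (fun y => T y *m T y - (r y)%:M)
      ((n%:R / 2) *: (B + adjoint_mx (G z) B)
         - ((2 * (u *m a z) 0 0) *: T z + (2 * (u *m T z *m a z) 0 0)%:M)).
    have dr := is_deriveN (is_derive_square_trace u cz).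
    have := is_nablaD (is_nabla_mul (cT u) (cT u)) (is_nabla_scalar (C z u) dr).
    have -> : (fun y => T y *m T y + ((- r) y)%:M) =
      (fun y => T y *m T y - (r y)%:M).
      by apply/funext => y; rewrite raddfN.
    congr is_nabla; rewrite raddfN opprD addrA; congr (_ - _).
    have Tad := adjoint_mx_id Gu Ts.
    have BE : B = a z *m u *m T z + T z *m (a z *m u) by rewrite mulmxA.
    rewrite BE adjoint_mxD !(adjoint_mx_mul _ _ Gu) Tad.
    exact: anticomm.
  by apply: is_nabla_near0 (is_nablaX k cQ); apply: (open_near oV Vz).
- by move/eqP; rewrite scaler_eq0 invr_eq0 (negbTE nR) => /eqP; left.
by right.
Qed.

End LocalCompatible.

(** * Locally constant functions and charts *)

Section LocallyConstant.
Context {R : realType} {n : nat}.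

Lemma derive0_segment (phi : R -> R) :
  (forall s : R, s \in `[0, 1] -> is_derive s 1 phi 0) -> phi 1 = phi 0.
Proof.
move=> phiD; have le01 : (0 : R) <= 1 by apply: ler01.
have dphi (s : R) : s \in `]0, 1[ -> is_derive s 1 phi ((fun=> 0 : R) s).
  rewrite in_itv /= => /andP[/ltW s0 /ltW s1].
  by apply: phiD; rewrite in_itv /= s0 s1.
have cphi : {within `[0 : R, 1]%classic, continuous phi}.
  by apply: derivable_within_continuous => s si; have [] := phiD s si.
have [c _ E] := MVT_segment le01 dphi cphi.
by apply/eqP; rewrite -subr_eq0 E mul0r.
Qed.

Lemma derive0_near_constant (W : set 'rV[R]_n) (f : 'rV[R]_n -> R) y : open W ->
  (forall z u, W z -> is_derive z u f 0) -> W y -> \forall z \near y, f z = f y.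
Proof.
move=> oW df Wy;
  have /nbhs_ballP[e /= e0 eW] : nbhs y W by exact: open_nbhs_nbhs.
apply/nbhs_ballP; exists e => // z; rewrite -ball_normE /= => yz.
pose v := z - y; pose phi (s : R) := f (s *: v + y).
have phiD (s : R) : s \in `[0, 1] -> is_derive s 1 phi 0.
  rewrite in_itv /= => /andP[s0 s1]; have Ws : W (s *: v + y).
    apply: eW; rewrite -ball_normE /= opprD addrCA subrr addr0 normrN normrZ.
    rewrite ger0_norm // (le_lt_trans _ yz) // -[leRHS]mul1r distrC.
    by rewrite ler_wpM2r.
  have [dd d0] := df _ v Ws.
  have E : (fun h : R => h^-1 *: ((phi \o shift s) (h *: 1) - phi s)) =
      (fun h => h^-1 *: ((f \o shift (s *: v + y)) (h *: v) - f (s *: v + y))).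
    apply/funext => h; rewrite /phi /=; congr (_ *: (f _ - _)).
    by rewrite addrA -scalerDl [h *: 1]mulr1.
  by split; [rewrite /derivable E|rewrite /derive E].
have := derive0_segment phiD.
by rewrite /phi scale1r scale0r add0r subrK.
Qed.

End LocallyConstant.

Section Charts.
Context {R : realType} {n : nat} (M : smooth_manifold R n).
Implicit Types (c : chart M) (U : set M) (x : M).

Lemma chart_imageP c U y : (cmap c @` (cdom c `&` U)) y ->
  [/\ cdom c (cinv c y), U (cinv c y) & cmap c (cinv c y) = y].
Proof. by move=> [x [cx Ux] <-]; rewrite (cmapK cx). Qed.

Lemma chart_image_open c U : open U -> open (cmap c @` (cdom c `&` U)).
Proof.
move=> oU; have oI := @cimage_open _ _ M c.
have := @cinv_continuous _ _ M c; rewrite (continuous_open_subspace _ oI) => cc.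
rewrite openE => y Wy; have [cy Uy yE] := chart_imageP Wy.
have Iy : (cmap c @` cdom c) y by exists (cinv c y).
have : \forall z \near y, U (cinv c z).
  by apply: (cc y); [rewrite inE|exact: open_nbhs_nbhs].
have : \forall z \near y, (cmap c @` cdom c) z by exact: open_nbhs_nbhs.
apply: filterS2 => z [x cx <-]; rewrite (cmapK cx) => Ux.
by exists x.
Qed.

Lemma chart_near c x (P : 'rV[R]_n -> Prop) : cdom c x ->
  (\forall y \near cmap c x, P y) ->
    \forall z \near x, cdom c z /\ P (cmap c z).
Proof.
move=> cx Px; have od := @cdom_open _ _ M c.
have := @cmap_continuous _ _ M c; rewrite (continuous_open_subspace _ od) => cc.
have cP : \forall z \near x, P (cmap c z) by apply: (cc x) => //; rewrite inE.
have : \forall z \near x, cdom c z by exact: open_nbhs_nbhs.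
by apply: filterS2 cP => z.
Qed.

Lemma locally_constant_connected (T : Type) (f : M -> T) U : open U ->
  connected U ->
  (forall x, U x -> \forall z \near x, f z = f x) ->
  forall x y, U x -> U y -> f x = f y.
Proof.
move=> oU cU lf x y Ux Uy.
have opn (P : set T) : open (U `&` f @^-1` P).
  rewrite openE => z [Uz Pz].
  have : nbhs z U by exact: open_nbhs_nbhs.
  by apply: filterS2 (lf z Uz) => w /= -> Uw; split.
have : U `&` f @^-1` [set f x] = U.
  apply: cU; first by exists x.
    by exists (U `&` f @^-1` [set f x]); rewrite // setIA setIid.
  exists (~` (U `&` f @^-1` (~` [set f x]))); first exact: open_closedC.
  apply/seteqP; split=> z /= [Uz]; last by move=> h; split=> //;
    apply: contrapT => fz; apply: h.
  by move=> fz; split=> // -[].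
by move=> /seteqP[_ /(_ y Uy)] [].
Qed.

End Charts.

(** * The eigenvalue of a compatible field is locally constant *)

Section CompatibleInChart.
Context {R : realType} {n : nat} (M : smooth_manifold R n).
Context (g L : components M).
Context (hg : pseudo_riemannian_on setT g) (hL : compatible g L).
Implicit Types (c : chart M) (U : set M) (x : M) (y u : 'rV[R]_n).

Lemma selfadjoint_mxP (G A : 'M[R]_n) : selfadjoint_mx G A <-> A *m G =
  G *m A^T.
Proof.
split=> [h|h v w]; last by rewrite trmx_mul -(mulmxA v A) h !mulmxA.
apply/matrixP => i j; have := h (delta_mx 0 i) (delta_mx 0 j).
rewrite trmx_mul trmx_delta !mulmxA -(mulmxA _ A) -(mulmxA _ G) -!rowE -!colE.
by move=> /matrixP/(_ 0 0); rewrite !mxE.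
Qed.

Lemma smooth_in_chart c (T : components M) U : open U ->
  smooth_components setT T ->
  smooth_on (cmap c @` (cdom c `&` U)) (in_chart c (T c)).
Proof.
move=> oU sT; apply: smooth_subset (sT c); apply: image_subset.
by apply: setIS.
Qed.

Definition chart_compatible c y : Prop :=
  compatible_at (in_chart c (g c)) (fun y => connection_mx g c (cinv c y))
    (in_chart c (L c)) (fun y => dtrace L c (cinv c y)) y.

Lemma compatible_in_chart c U y : open U -> (cmap c @` (cdom c `&` U)) y ->
  chart_compatible c y.
Proof.
move=> oU Wy; have [cy Uy yE] := chart_imageP Wy.
have [[sL _] hc] := hL; have [Ls Lu nab] := hc _ _ cy.
have [_ /(_ _ _ I cy) [Gs Gu]] := hg.
split=> //; first exact/selfadjoint_mxP.
move=> u A; have := nab u; rewrite /nabla_endo /partial yE.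
have dL : is_derive y u (in_chart c (L c)) ('D_u (in_chart c (L c)) y).
  apply: derivableP; apply: diff_derivable.
  have sLW : smooth_on (cmap c @` (cdom c `&` U)) (in_chart c (L c)).
    exact: smooth_in_chart.
  exact: smooth_differentiable sLW Wy.
move: dL => /[swap] E; rewrite /is_nabla; congr is_derive.
by rewrite /= -E /in_chart /= subrK addrK.
Qed.

Lemma dtrace_continuous c U y : open U -> (cmap c @` (cdom c `&` U)) y ->
  {for y, continuous (fun y => dtrace L c (cinv c y))}.
Proof.
move=> oU Wy; set W := _ @` _ in Wy.
have oW : open W by exact: chart_image_open.
have [[sL _] _] := hL;
  have sLW : smooth_on W (in_chart c (L c)) by exact: smooth_in_chart.
pose D (z : 'rV[R]_n) : 'cV[R]_n :=
  \col_j \tr ('D_(delta_mx 0 j) (in_chart c (L c)) z).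
have DE z : W z -> D z = dtrace L c (cinv c z).
  move=> Wz; have [cz Uz zE] := chart_imageP Wz.
  apply/matrixP => j k; rewrite !mxE /partial zE.
  have dL : is_derive z (delta_mx 0 j : 'rV_n) (in_chart c (L c)) ('D_(delta_mx
    0 j) (in_chart c (L c)) z).
    by apply: derivableP; apply: diff_derivable;
      apply: smooth_differentiable Wz.
  by have [_ <-] := is_derive_trace dL.
apply: differentiable_continuous.
apply: (@near_eq_differentiable _ _ _ D).
  exact: open_near oW Wy DE.
apply/differentiable_mxP => j k.
have -> : (fun z => D z j k) =
    \sum_i (fun z => 'D_(delta_mx 0 j) (in_chart c (L c)) z i i).
  by apply/funext => z; rewrite mxE fct_sumE.
apply: differentiable_sum => i.
have := smooth_differentiable (smooth_derive (delta_mx 0 j) sLW) Wy.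
by move=> /differentiable_mxP.
Qed.

Section UniqueEigenvalue.
Context (U : set M) (lam : M -> R[i]^o) (oU : open U).
Context (heig :
  (forall c x, U x -> cdom c x -> unique_real_eigenvalue (L c x) (lam x)) \/
  (forall c x, U x -> cdom c x -> unique_complex_pair (L c x) (lam x))).
Context (hmult : forall c x, U x -> cdom c x ->
  (2 <= geometric_multiplicity (L c x) (lam x))%N).

Let heig1 c x : U x -> cdom c x ->
  unique_real_eigenvalue (L c x) (lam x) \/ unique_complex_pair (L c x) (lam x).
Proof. by move=> Ux cx; case: heig => h; [left|right]; exact: h. Qed.

Lemma dim_gt0 x : U x -> (0 < n)%N.
Proof.
move=> Ux; have [c cx] := cdom_cover x; have := hmult Ux cx.
rewrite /geometric_multiplicity; case: ifP => _ h2.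
  have := rank_leq_row (eigenspace (L c x) (complex.Re (lam x))); lia.
have := rank_leq_row (eigenspace (complexify (L c x)) (lam x)); lia.
Qed.

Lemma trace_free_spectral c x : U x -> cdom c x ->
  L c x - (n%:R^-1 * \tr (L c x))%:M = L c x - (complex.Re (lam x))%:M.
Proof.
move=> Ux cx; rewrite (mxtrace_spectral (heig1 Ux cx)) mulKf //.
by rewrite pnatr_eq0 -lt0n (dim_gt0 Ux).
Qed.

Lemma square_trace_spectral c x : U x -> cdom c x ->
  let T := L c x - (complex.Re (lam x))%:M in
  n%:R^-1 * \tr (T *m T) = - complex.Im (lam x) ^+ 2.
Proof.
move=> Ux cx T; have n0 := dim_gt0 Ux.
have nR : n%:R != 0 :> R by rewrite pnatr_eq0 -lt0n.
have [rA|cA] := heig1 Ux cx.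
  have Tn := nilpotent_real rA (hmult Ux cx).
  rewrite (@nilpotent_trace _ _ (T *m T) n.-1) ?mulr0; last first.
    by rewrite mulmxE -expr2 exprAC Tn expr2 mulr0.
  by have [-> _] := rA; rewrite expr0n oppr0.
have [k nk /=] := nilpotent_pair cA (hmult Ux cx).
move=> /nilpotent_trace; rewrite mxtraceB mxtrace_scalar -/T => /eqP.
rewrite subr_eq0 => /eqP ->; rewrite -[X in _ * X]mulr_natl mulKf //.
Qed.

(** The order of nilpotency given by the two independent eigenvectors is
    smaller than the one at which the identities of constant_trace_real and
    constant_trace_pair become empty. *)
Lemma dtrace_eq0 c x : U x -> cdom c x -> dtrace L c x = 0.
Proof.
move=> Ux cx; set W := cmap c @` (cdom c `&` U).
have oW : open W by exact: chart_image_open.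
have n0 := dim_gt0 Ux; have Wx : W (cmap c x) by exists x.
have cW y : W y -> chart_compatible c y by exact: compatible_in_chart.
have tW y : W y -> {for y, continuous (fun y => dtrace L c (cinv c y))}.
  exact: dtrace_continuous.
suff : dtrace L c (cinv c (cmap c x)) = 0 by rewrite (cmapK cx).
move: (cmap c x) Wx; case: heig => h.
  apply: (constant_trace_real n0 oW _ cW tW (m := n.-1));
    first by rewrite prednK.
  move=> y Wy; have [cy Uy yE] := chart_imageP Wy.
  rewrite /trace_free /in_chart /= trace_free_spectral //.
  exact: nilpotent_real (h _ _ Uy cy) (hmult Uy cy).
have [k nk _] := nilpotent_pair (h _ _ Ux cx) (hmult Ux cx).
apply: (constant_trace_pair n0 oW _ cW tW (m := k)).
- by rewrite nk ltn_double.
- move=> y Wy; have [cy Uy yE] := chart_imageP Wy.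
  rewrite /square_trace /trace_free /in_chart /= trace_free_spectral //.
  rewrite square_trace_spectral // oppr_lt0 exprn_even_gt0 //=.
  by apply/eqP; have [] := h _ _ Uy cy.
move=> y Wy; have [cy Uy yE] := chart_imageP Wy.
rewrite /square_trace /trace_free /in_chart /= trace_free_spectral //.
rewrite square_trace_spectral //.
have [k' nk' /=] := nilpotent_pair (h _ _ Uy cy) (hmult Uy cy).
by have -> : k = k' by lia.
Qed.

(** The real part of the eigenvalue is tr L / n and the square of the
    imaginary part is - tr T^2 / n; both are functions with derivative 0. *)
Lemma eigenvalue_parts_near_constant x : U x -> \forall z \near x,
  complex.Re (lam z) = complex.Re (lam x) /\
  complex.Im (lam z) ^+ 2 = complex.Im (lam x) ^+ 2.
Proof.
move=> Ux; have [c cx] := cdom_cover x; set W := cmap c @` (cdom c `&` U).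
have oW : open W by exact: chart_image_open.
have n0 := dim_gt0 Ux; have Wx : W (cmap c x) by exists x.
have nR : n%:R != 0 :> R by rewrite pnatr_eq0 -lt0n.
have cW y : W y -> chart_compatible c y by exact: compatible_in_chart.
have t0 y : W y -> dtrace L c (cinv c y) = 0.
  by move=> Wy; have [cy Uy _] := chart_imageP Wy; exact: dtrace_eq0.
have d1 y u : W y -> is_derive y u (fun z => \tr (in_chart c (L c) z)) 0.
  move=> Wy; have := is_derive_trL u (cW y Wy).
  by rewrite t0 // mulmx0 mxE.
have d2 y u : W y -> is_derive y u (square_trace (in_chart c (L c))) 0.
  move=> Wy; have := is_derive_square_trace n0 u (cW y Wy).
  by rewrite t0 // scaler0 mulmx0 mxE mulr0.
have n1 := derive0_near_constant oW d1 Wx.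
have n2 := derive0_near_constant oW d2 Wx.
have : \forall y \near cmap c x, [/\ W y,
   \tr (in_chart c (L c) y) = \tr (in_chart c (L c) (cmap c x)) &
   square_trace (in_chart c (L c)) y =
     square_trace (in_chart c (L c)) (cmap c x)].
  near=> y; split; near: y => //.
  exact: open_nbhs_nbhs.
move=> /(chart_near cx); apply: filterS => z [cz [Wz]].
have [_ Uz _] := chart_imageP Wz; move: Uz; rewrite (cmapK cz) => Uz.
rewrite /square_trace /trace_free /in_chart /= (cmapK cx) (cmapK cz).
rewrite !trace_free_spectral // !square_trace_spectral //.
rewrite (mxtrace_spectral (heig1 Uz cz)) (mxtrace_spectral (heig1 Ux cx)).
by move=> /(mulfI nR) -> /oppr_inj.
Unshelve. all: by end_near. Qed.

End UniqueEigenvalue.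
End CompatibleInChart.

Section ContinuousEigenvalue.
Context {R : realType} {T : topologicalType}.

Lemma normc_ge_Im (w : R[i]) : `|complex.Im w|%:C <= `|w|.
Proof. by rewrite normc_def lecR -sqrtr_sqr ler_wsqrtr // lerDr sqr_ge0. Qed.

(** The continuity of the eigenvalue enters here: the square of the
    imaginary part determines it up to the sign, and the sign cannot jump. *)
Lemma continuous_near_eq (lam : T -> R[i]^o) x : {for x, continuous lam} ->
  (\forall z \near x, complex.Re (lam z) = complex.Re (lam x) /\
    complex.Im (lam z) ^+ 2 = complex.Im (lam x) ^+ 2) ->
  \forall z \near x, lam z = lam x.
Proof.
move=> cl; set b := complex.Im (lam x).
have [b0|b0] := eqVneq b 0.
  apply: filterS => z [eR]; rewrite b0 expr0n /= => /eqP;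
    rewrite sqrf_eq0 => /eqP eI.
  by apply/eqP; rewrite eq_complex eR eI -/b b0 !eqxx.
have e0 : (0 : R[i]) < `|b|%:C by rewrite ltcR normr_gt0.
have lx : \forall z \near x, `|lam x - lam z| < `|b|%:C.
  by move/cvgrPdist_lt: cl => /(_ _ e0).
apply: filterS2 lx => z lz [eR /eqP]; rewrite eqf_sqr => /orP[/eqP eI|/eqP eI].
  by apply/eqP; rewrite eq_complex eR eI !eqxx.
have := le_lt_trans (normc_ge_Im _) lz.
rewrite ltcR raddfB /= eI -/b opprK -mulr2n normrMn ltNge.
by rewrite mulr2n lerDl normr_ge0.
Qed.

End ContinuousEigenvalue.

(** * The Levi-Civita connection *)

Section Metric.
Context {R : realType} {n : nat}.
Implicit Types (G H : 'M[R]_n).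

(** Christoffel symbols at a point, as a function of the value G of the
    metric and of its partial derivatives d k. *)
Definition koszul G (d : 'I_n -> 'M[R]_n) (i k l : 'I_n) : R :=
  2^-1 * \sum_m invmx G i m * (d k m l + d l m k - d m k l).

Definition koszul_mx G d k : 'M[R]_n := \matrix_(l, i) koszul G d i k l.

(** The Levi-Civita connection preserves the metric. *)
Lemma koszul_metric G d k : G \in unitmx -> G^T = G ->
  (forall k, (d k)^T = d k) ->
  d k = koszul_mx G d k *m G + G *m (koszul_mx G d k)^T.
Proof.
move=> Gu Gs ds.
have ds' m i j : d m i j = d m j i by rewrite -[in LHS](ds m) mxE.
have E l j : (koszul_mx G d k *m G) l j = 2^-1 * (d k j l + d l j k - d j k l).
  rewrite mxE.
  transitivity (2^-1 * \sum_m (\sum_i invmx G i m * G i j) * (d k m l + d l m k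
    - d m k l)).
    under eq_bigr do rewrite mxE /koszul -mulrA.
    rewrite -mulr_sumr; congr (_ * _).
    under eq_bigr do rewrite mulr_suml.
    rewrite exchange_big /=; apply: eq_bigr => m _; rewrite mulr_suml.
    by apply: eq_bigr => i _; rewrite mulrAC.
  congr (_ * _); rewrite (bigD1 j) //= [X in _ + X]big1 => [|m mj].
    rewrite addr0; have -> : \sum_i invmx G i j * G i j = 1;
      last by rewrite mul1r.
    have /matrixP/(_ j j) := mulmxV Gu;
      rewrite mxE [in RHS]mxE eqxx mulr1n => <-.
    apply: eq_bigr => i _; rewrite -[in G i j]Gs mxE mulrC //.
  have -> : \sum_i invmx G i m * G i j = 0; last by rewrite mul0r.
  have /matrixP/(_ j m) := mulmxV Gu;
    rewrite mxE [in RHS]mxE eq_sym (negbTE mj) mulr0n => e.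
  rewrite -[RHS]e.
  by apply: eq_bigr => i _; rewrite -[in G i j]Gs mxE mulrC.
apply/matrixP => l j.
have -> : G *m (koszul_mx G d k)^T = (koszul_mx G d k *m G)^T.
  by rewrite trmx_mul Gs.
rewrite [RHS]mxE E [X in _ + X]mxE E.
rewrite (ds' k j l) (ds' l j k) (ds' j l k); by field.
Qed.

(** The Levi-Civita connection is the only symmetric one that preserves the
    metric. *)
Lemma koszul_unique H d (C : 'I_n -> 'M[R]_n) : H \in unitmx -> H^T = H ->
  (forall k l i, C k l i = C l k i) ->
    (forall k, d k = C k *m H + H *m (C k)^T) ->
  forall i k l, koszul H d i k l = C k l i.
Proof.
move=> Hu Hs Cs dE i k l.
pose P k := C k *m H.
have Ps p q j : P p q j = P q p j.
  by rewrite !mxE; apply: eq_bigr => m _; rewrite Cs.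
have dP p q j : d p q j = P p q j + P p j q.
  have E : d p = P p + (P p)^T by rewrite dE /P trmx_mul Hs.
  by rewrite E mxE [X in _ + X]mxE.
rewrite /koszul (eq_bigr (fun m => 2 * (P k l m * invmx H m i))) => [|m _].
  rewrite -mulr_sumr mulKf ?pnatr_eq0 //.
  have : P k *m invmx H = C k by rewrite mulmxK.
  by move=> /matrixP/(_ l i); rewrite mxE.
have -> : invmx H i m = invmx H m i by rewrite -[in LHS]Hs -trmx_inv mxE.
rewrite !dP (Ps k m l) (Ps l m k) (Ps l k m); ring.
Qed.

End Metric.

(** * The inverse of an endomorphism field *)

Section InverseMatrix.
Context {R : realType}.

(** The Cayley-Hamilton theorem, solved for the inverse. *)
Lemma invmx_horner n (A : 'M[R]_n.+1) : A \in unitmx ->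
  let X := char_poly A in
  invmx A = horner_mx A (- (X`_0)^-1 *: drop_poly 1 X).
Proof.
move=> Au X.
have X0 : X`_0 != 0.
  rewrite /X char_poly_det mulf_neq0 ?signr_eq0 //.
  by rewrite -unitfE -unitmxE.
have /= := Cayley_Hamilton A;
  rewrite -/X -[X in horner_mx _ X](poly_take_drop 1).
have -> : take_poly 1 X = (X`_0)%:P.
  by apply/polyP => i; rewrite coef_take_poly coefC; case: i.
rewrite rmorphD rmorphM /= horner_mx_C horner_mx_X => /eqP.
rewrite addrC addr_eq0 => /eqP E.
have {}E : horner_mx A (- (X`_0)^-1 *: drop_poly 1 X) *m A = 1%:M.
  rewrite linearZ /= -scalemxAl mulmxE E scalerN scaleNr opprK -mul_scalar_mx.
  by rewrite -scalar_mxM mulVf.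
by rewrite -[RHS]mulmx1 -(mulmxV Au) mulmxA E mul1mx.
Qed.

(** When the characteristic polynomial is constant, the inverse is a fixed
    polynomial in F, so smoothness follows from that of sums and products. *)
Lemma smooth_invmx n m (A : set 'rV[R]_m) (F : 'rV[R]_m ->
  'M[R]_n) X : open A ->
  smooth_on A F -> (forall y, A y -> F y \in unitmx) ->
  (forall y, A y -> char_poly (F y) = X) ->
  smooth_on A (fun y => invmx (F y)).
Proof.
case: n F => [|n] F oA sF Fu FX.
  by have -> : (fun y => invmx (F y)) = F by apply/funext => y;
    apply/matrixP => -[].
apply: smooth_eq oA _ (smooth_horner_mx (- (X`_0)^-1 *: drop_poly 1 X) oA sF).
by move=> y Ay; rewrite invmx_horner ?FX //; exact: Fu.
Qed.

Lemma is_nabla_inv n (C : 'M[R]_n) (y u : 'rV[R]_n) F : F y \in unitmx ->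
  (\forall z \near y, F z \in unitmx) -> derivable (fun z => invmx (F z)) y u ->
  is_nabla C y u F 0 -> is_nabla C y u (fun z => invmx (F z)) 0.
Proof.
move=> Fu nF /derivableP dK dF; set K := fun z => invmx (F z) in dK *.
have : \forall z \near y, F z *m K z = 1%:M by apply: filterS nF => z;
  exact: mulmxV.
move=> /is_derive_near_cst/(_ (is_derive_mulmx dF dK)) E.
rewrite /is_nabla;
  suff -> : 0 + C *m invmx (F y) - invmx (F y) *m C = 'D_u K y by [].
have : K y *m ((0 + C *m F y - F y *m C) *m K y + F y *m 'D_u K y) =
  0 by rewrite E mulmx0.
rewrite mulmxDr !mulmxA mulVmx // mul1mx !add0r mulmxBr !mulmxA mulVmx //
  mul1mx.
rewrite mulmxBl -(mulmxA _ (F y)) mulmxV // mulmx1.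
by move/eqP; rewrite addrC addr_eq0 opprB => /eqP.
Qed.

End InverseMatrix.

(** * The metric gbar *)

Section ParallelInChart.
Context {R : realType} {n : nat} (M : smooth_manifold R n).
Context (g L : components M).
Context (hg : pseudo_riemannian_on setT g) (hL : compatible g L).
Context (U : set M) (oU : open U).
Context (tU : forall c x, U x -> cdom c x -> dtrace L c x = 0).

Lemma parallel_of_dtrace : parallel_on U g L.
Proof.
move=> c x Ux cx u; have [_ /(_ _ _ cx) [_ _ ->]] := hL.
by rewrite tU // /tensor_op mul0mx /adjoint_mx mulmx0 mul0mx trmx0 addr0
  scaler0.
Qed.

Lemma connection_koszul (h : components M) c x k :
  connection_mx h c x (delta_mx 0 k)
    = koszul_mx (h c x) (fun j => partial c (h c) (delta_mx 0 j) x) k.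
Proof.
apply/matrixP => l i; rewrite !mxE (bigD1 k) //= big1 => [|j jk].
  by rewrite mxE !eqxx mul1r addr0.
by rewrite mxE (negbTE jk) andbF mul0r.
Qed.

Lemma koszul_sym G (d : 'I_n -> 'M[R]_n) i k l : (forall k, (d k)^T = d k) ->
  koszul G d i k l = koszul G d i l k.
Proof.
move=> ds; rewrite /koszul; congr (_ * _); apply: eq_bigr => m _; congr (_ * _).
by rewrite -[in d m k l](ds m) mxE [d k m l + _]addrC.
Qed.

Let W c := cmap c @` (cdom c `&` U).

Let sG c : smooth_on (W c) (in_chart c (g c)).
Proof. by have [[sg _] _] := hg; exact: smooth_in_chart. Qed.

Lemma partial_metric_sym c x k : U x -> cdom c x ->
  (partial c (g c) (delta_mx 0 k) x)^T = partial c (g c) (delta_mx 0 k) x.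
Proof.
move=> Ux cx; rewrite /partial; set e := delta_mx 0 k : 'rV_n.
have Wx : W c (cmap c x) by exists x.
have oW : open (W c) by exact: chart_image_open.
have dG : is_derive (cmap c x) e (in_chart c (g c)) ('D_e (in_chart c (g c))
  (cmap c x)).
  by apply: derivableP; apply: diff_derivable; apply: smooth_differentiable Wx.
apply/matrixP => i j; rewrite mxE; have /is_derive_mxP dGe := dG.
have [_ <-] := dGe i j; have [_ <-] := dGe j i.
apply: near_eq_derive; apply: (open_near oW Wx) => y Wy.
have [cy _ _] := chart_imageP Wy; have [_ /(_ _ _ I cy) [Gs _]] := hg.
by rewrite /in_chart /= -[in LHS]Gs mxE.
Qed.

Context (X : {poly R}) (hX : forall c x, U x -> cdom c x ->
  char_poly (L c x) = X).

Lemma det_const c x : U x -> cdom c x -> `|\det (L c x)| = `|X`_0|.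
Proof.
move=> Ux cx; rewrite -(hX Ux cx) char_poly_det normrM normrX normrN1.
by rewrite expr1n mul1r.
Qed.

Let K c (y : 'rV[R]_n) : 'M[R]_n := invmx (in_chart c (L c) y).
Let kappa : R := `|X`_0|^-1.

Lemma gbar_in_chart c y : W c y ->
  in_chart c (gbar g L c) y = kappa%:M *m (K c y *m in_chart c (g c) y).
Proof.
move=> /chart_imageP[cy Uy _].
by rewrite /in_chart /= /gbar det_const // mul_scalar_mx.
Qed.

Lemma smooth_inv_L c : smooth_on (W c) (K c).
Proof.
have [[sL _] hc] := hL; apply: (@smooth_invmx _ _ _ _ _ X).
- exact: chart_image_open.
- exact: smooth_in_chart.
- by move=> y /chart_imageP[cy _ _]; have [] := hc _ _ cy.
- by move=> y /chart_imageP[cy Uy _]; exact: hX.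
Qed.

Lemma gbar_pseudo_riemannian : pseudo_riemannian_on U (gbar g L).
Proof.
have [[_ hJ] hGs] := hg; have [[_ LJ] hc] := hL.
split; first split.
- move=> c; have oW : open (W c) by exact: chart_image_open.
  apply: (smooth_eq oW); first by move=> y /gbar_in_chart ->.
  apply: smooth_mulmx => //; first exact: smooth_cst.
  by apply: smooth_mulmx => //; exact: smooth_inv_L.
- move=> c d x Ux cx dx J; have [_ Lu _] := hc _ _ cx;
  have [_ Ld _] := hc _ _ dx.
  rewrite /gbar !det_const // -scalemxAr -scalemxAl; congr (_ *: _).
  have LJx := LJ _ _ _ I cx dx; rewrite -/J in LJx.
  rewrite (hJ _ _ _ I cx dx) -/J !mulmxA; congr (_ *m _ *m _).
  by rewrite -[RHS](mulKmx Lu) [L c x *m _]mulmxA LJx mulmxK.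
move=> c x Ux cx; have [Gs Gu] := hGs _ _ I cx;
  have [/selfadjoint_mxP Ls Lu _] := hc _ _ cx.
split; last first.
  rewrite /gbar unitmxZ ?unitmx_mul ?unitmx_inv ?Lu //.
  by rewrite unitfE invr_eq0 normr_eq0 -unitfE -unitmxE.
rewrite /gbar linearZ /= trmx_mul Gs trmx_inv; congr (_ *: _).
rewrite -[LHS](mulKmx Lu) (mulmxA _ _ (invmx _)) Ls mulmxK //.
by rewrite unitmx_tr.
Qed.

(** As L is parallel, so is its inverse, and det L is constant; hence the
    connection of g preserves gbar, and koszul_unique applies. *)
Lemma gbar_christoffel c x i k l : U x -> cdom c x ->
  christoffel g c x i k l = christoffel (gbar g L) c x i k l.
Proof.
move=> Ux cx; have [_ /(_ _ _ Ux cx) [Hs Hu]] := gbar_pseudo_riemannian.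
have [_ /(_ _ _ I cx) [Gs Gu]] := hg.
have Wx : W c (cmap c x) by exists x.
have oW : open (W c) by exact: chart_image_open.
set C := fun k => connection_mx g c x (delta_mx 0 k).
have Cs p q j : C p q j = C q p j.
  rewrite /C !connection_koszul !mxE koszul_sym // => r.
  exact: partial_metric_sym.
rewrite -[RHS]/(koszul (gbar g L c x) (fun j => partial c (gbar g L c)
  (delta_mx 0 j) x) i k l).
rewrite (@koszul_unique _ _ _ _ C) // /C.
  by rewrite connection_koszul mxE.
move=> p; set e : 'rV[R]_n := delta_mx 0 p.
have xE : cinv c (cmap c x) = x := cmapK cx.
have dG : is_derive (cmap c x) e (in_chart c (g c)) (C p *m g c x + g c x *m (C
  p)^T).
  rewrite /C connection_koszul -koszul_metric //; last by move=> r;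
    exact: partial_metric_sym.
  apply: derivableP; apply: diff_derivable; apply: smooth_differentiable Wx.
  exact: sG.
have dK : is_nabla (C p) (cmap c x) e (K c) 0.
  have [[sL _] hc] := hL; have [_ Lu _] := hc _ _ cx.
  apply: is_nabla_inv; first by rewrite /in_chart /= xE.
  - apply: (open_near oW Wx) => y /chart_imageP[cy _ _].
    by have [] := hc _ _ cy.
  - apply: diff_derivable; apply: smooth_differentiable Wx; exact: smooth_inv_L.
  have [_ _ _ /(_ e)] := compatible_in_chart hg hL oU Wx.
  rewrite xE tU // mul0mx /adjoint_mx mulmx0 mul0mx trmx0 addr0 scaler0.
  by [].
have := is_derive_mulmx (is_derive_cst kappa%:M (cmap c x) e) (is_derive_mulmx
  dK dG).
have nE : \forall y \near cmap c x,
    kappa%:M *m (K c y *m in_chart c (g c) y) = in_chart c (gbar g L c) y.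
  by apply: (open_near oW Wx) => y Wy; rewrite gbar_in_chart.
move=> /(near_eq_is_derive nE) [_]; rewrite /partial => ->.
rewrite mul0mx add0r.
have -> : gbar g L c x = kappa%:M *m (K c (cmap c x) *m g c x).
  by have := gbar_in_chart Wx; rewrite /in_chart /= xE.
rewrite [in_chart c (g c) _]/in_chart /= xE -/(C p).
rewrite !mul_scalar_mx -scalemxAr -scalemxAl -scalerDr; congr (_ *: _).
by rewrite add0r mulmxBl mulmxDr !mulmxA addrA subrK.
Qed.

Lemma gbar_affinely_equivalent : affinely_equivalent_on U g (gbar g L).
Proof.
split; first 1 last.
- exact: gbar_pseudo_riemannian.
- by move=> c x Ux cx i k l; exact: gbar_christoffel.
have [[sg hJ] hs] := hg; split; first split.
- by move=> c; exact: smooth_in_chart.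
- by move=> c d x _; exact: hJ.
- by move=> c x _; exact: hs.
Qed.

End ParallelInChart.

Theorem theorem1p4 (R : realType) (n : nat) (M : smooth_manifold R n)
    (g L : components M) (p : M) (U : set M) (lam : M -> R[i]^o)
    (hg : pseudo_riemannian_on setT g)
    (hL : compatible g L)
    (hp : regular_point L p)
    (hUopen : open U) (hUconn : connected U) (hUp : U p)
    (hlam : {within U, continuous lam})
    (heig :
      (forall c x, U x -> cdom c x -> unique_real_eigenvalue (L c x) (lam x)) \/
      (forall c x, U x -> cdom c x -> unique_complex_pair (L c x) (lam x)))
    (hmult : forall c x, U x -> cdom c x ->
      (2 <= geometric_multiplicity (L c x) (lam x))%N) :
  [/\ forall x y, U x -> U y -> lam x = lam y,
      parallel_on U g L &
      affinely_equivalent_on U g (gbar g L)].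
Proof.
have tU c x : U x -> cdom c x -> dtrace L c x = 0.
  by move=> Ux cx; exact: (dtrace_eq0 hg hL hUopen heig hmult).
have lamU x y : U x -> U y -> lam x = lam y.
  apply: (locally_constant_connected hUopen hUconn) => z Uz.
  apply: continuous_near_eq.
    move: hlam; rewrite (continuous_open_subspace _ hUopen); apply.
    by rewrite inE.
  exact: (eigenvalue_parts_near_constant hg hL hUopen heig hmult).
split=> //; first exact: parallel_of_dtrace.
have [c0 c0p] := cdom_cover p.
apply: (@gbar_affinely_equivalent _ _ _ _ _ hg hL U hUopen tU (char_poly (L c0
  p))).
move=> c x Ux cx; apply: (map_poly_inj (real_complex R)).
rewrite /= !map_char_poly -!/(complexify _) (char_poly_spectral (z := lam x)).
  rewrite (char_poly_spectral (z := lam p)) ?(lamU x p) //.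
  by case: heig => h; [left|right]; exact: h.
by case: heig => h; [left|right]; exact: h.
Qed.
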